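(* Let $T$ be a monadically NIP theory. Then for every small set $A$, the forking independence relation $\downarrow^f$ satisfies BS-triviality over $A$: for all tuples $\bar a,\bar b$ with $\bar b\downarrow^f_A\bar a$ and every singleton $c$, either $\bar b c\downarrow^f_A\bar a$ or $\bar b\downarrow^f_A\bar a c$.
   Context: $T$ is a complete first-order theory and $\mathbb{M}\models T$ is a sufficiently saturated and homogeneous monster model; ''small'' means of size less than the saturation of $\mathbb{M}$. Tuples are small tuples of elements of $\mathbb{M}$ (possibly infinite unless said otherwise), a singleton is a single element of $\mathbb{M}$, parameter sets are small subsets of $\mathbb{M}$, and juxtaposition denotes concatenation of tuples / union of sets. $T$ is monadically NIP if every expansion of every model of $T$ by unary predicates is NIP. A formula $\varphi(x,b)$ with parameters in $\mathbb{M}$ divides over a small set $A$ if there is an $A$-indiscernible sequence $(b_i)_{i\in\omega}$ with $b_i\equiv_A b$ such that $\{\varphi(x,b_i):i\in\omega\}$ is inconsistent. It forks over $A$ if it implies a finite disjunction of formulas (with parameters in $\mathbb{M}$), each dividing over $A$. A partial type forks over $A$ if it implies a formula which forks over $A$. Write $a\downarrow^f_A b$ if $\operatorname{tp}(a/Ab)$ does not fork over $A$. *)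

(* Defs.v *)
From mathcomp Require Import all_boot.
From mathcomp Require Import boolp classical_sets functions cardinality.

Set Implicit Arguments.
Unset Strict Implicit.
Unset Printing Implicit Defensive.

Local Open Scope classical_set_scope.
Local Open Scope card_scope.

Record language : Type := Language {
  fn_sym : Type;
  rel_sym : Type;
  fn_arity : fn_sym -> nat;
  rel_arity : rel_sym -> nat }.

Record structure (L : language) : Type := Structure {
  carrier :> Type;
  carrier_inhabited : inhabited carrier;
  fn_interp : forall f : fn_sym L, ('I_(fn_arity f) -> carrier) -> carrier;
  rel_interp : forall r : rel_sym L, ('I_(rel_arity r) -> carrier) -> Prop }.

(* [V] is the type of the variables which may occur free. *)
Inductive term (L : language) (V : Type) : Type :=
| tvar : V -> term L V
| tapp : forall f : fn_sym L, ('I_(fn_arity f) -> term L V) -> term L V.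

(* The quantifier of [fall] binds the variable [None]. The omitted connectives
   and the existential quantifier are definable classically. *)
Inductive formula (L : language) (V : Type) : Type :=
| fbot : formula L V
| feq : term L V -> term L V -> formula L V
| frel : forall r : rel_sym L, ('I_(rel_arity r) -> term L V) -> formula L V
| fimp : formula L V -> formula L V -> formula L V
| fall : formula L (option V) -> formula L V.

Arguments fbot {L V}.

Fixpoint eval (L : language) (M : structure L) (V : Type) (v : V -> M)
    (t : term L V) : M :=
  match t with
  | tvar x => v x
  | tapp _ ts => fn_interp (fun i => eval v (ts i))
  end.

Fixpoint sat (L : language) (M : structure L) (V : Type) (v : V -> M)
    (phi : formula L V) : Prop :=
  match phi with
  | fbot => False
  | feq t u => eval v t = eval v u
  | frel _ ts => rel_interp (fun i => eval v (ts i))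
  | fimp phi psi => sat v phi -> sat v psi
  | fall phi => forall m : M, sat (oapp v m) phi
  end.

Definition sentence (L : language) : Type := formula L void.

Definition theory (L : language) : Type := set (sentence L).

Definition holds (L : language) (M : structure L) (phi : sentence L) : Prop :=
  sat (of_void M) phi.

Definition models (L : language) (M : structure L) (T : theory L) : Prop :=
  forall phi, T phi -> holds M phi.

Definition entails (L : language) (T : theory L) (phi : sentence L) : Prop :=
  forall M : structure L, models M T -> holds M phi.

Definition complete_theory (L : language) (T : theory L) : Prop :=
  (exists M : structure L, models M T) /\
  forall phi, entails T phi \/ entails T (fimp phi fbot).

Definition Th (L : language) (M : structure L) : theory L :=
  [set phi | holds M phi].

(* Tuples are families; the concatenation is indexed by the disjoint sum. *)
Definition tcat (M I J : Type) (a : I -> M) (b : J -> M) : I + J -> M :=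
  fun k => match k with inl i => a i | inr j => b j end.

Definition singleton (M : Type) (c : M) : unit -> M := fun _ => c.

Definition has_IP (L : language) (T : theory L) (n m : nat)
    (phi : formula L ('I_n + 'I_m)) : Prop :=
  exists (N : structure L) (a : nat -> 'I_n -> N) (b : set nat -> 'I_m -> N),
    models N T /\ forall i S, sat (tcat (a i) (b S)) phi <-> S i.

Definition NIP (L : language) (T : theory L) : Prop :=
  forall n m (phi : formula L ('I_n + 'I_m)), ~ has_IP T phi.

Definition monadic_language (L : language) (P : Type) : language :=
  {| fn_sym := fn_sym L;
     rel_sym := rel_sym L + P;
     fn_arity := @fn_arity L;
     rel_arity := fun r => match r with inl r => rel_arity r | inr _ => 1 end |}.

Definition monadic_expansion (L : language) (N : structure L) (P : Type)
    (U : P -> set N) : structure (monadic_language L P) :=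
  @Structure (monadic_language L P) N (carrier_inhabited N)
    (fun f => @fn_interp L N f)
    (fun r => match r return
        ('I_(@rel_arity (monadic_language L P) r) -> N) -> Prop with
      | inl r0 => @rel_interp L N r0
      | inr p => fun x => U p (x ord0)
      end).

Definition monadically_NIP (L : language) (T : theory L) : Prop :=
  forall (N : structure L) (P : Type) (U : P -> set N),
    models N T -> NIP (Th (monadic_expansion U)).

(* The formula phi(x, b), with variables x indexed by [X] and a finite tuple b
   of parameters. *)
Record pformula (L : language) (M : structure L) (X : Type) : Type := PFormula {
  plen : nat;
  pform : formula L (X + 'I_plen);
  ppar : 'I_plen -> M }.

Arguments PFormula {L M X plen}.
Arguments ppar {L M X} p.
Arguments pform {L M X} p.

Definition psat (L : language) (M : structure L) (X : Type) (x : X -> M)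
    (phi : pformula M X) : Prop :=
  sat (tcat x (ppar phi)) (pform phi).

Definition params_in (L : language) (M : structure L) (X : Type) (A : set M)
    (phi : pformula M X) : Prop :=
  forall i, A (ppar phi i).

Definition realizes (L : language) (M : structure L) (X : Type) (x : X -> M)
    (p : set (pformula M X)) : Prop :=
  forall phi, p phi -> psat x phi.

Definition tp (L : language) (M : structure L) (X : Type) (a : X -> M)
    (A : set M) : set (pformula M X) :=
  [set phi | params_in A phi /\ psat a phi].

Definition card_lt (T U : Type) (A : set T) (B : set U) : Prop :=
  (A #<= B) /\ ~ (B #<= A).

(* The cardinal kappa is given by a type [K] of cardinality kappa. *)
Definition small (K T : Type) (A : set T) : Prop := card_lt A [set: K].

Definition saturated (K : Type) (L : language) (M : structure L) : Prop :=
  forall (A : set M) (n : nat) (p : set (pformula M 'I_n)),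
    small K A ->
    (forall phi, p phi -> params_in A phi) ->
    (forall q, finite_set q -> q `<=` p -> exists x : 'I_n -> M, realizes x q) ->
    exists x : 'I_n -> M, realizes x p.

Definition automorphism (L : language) (M : structure L) (s : M -> M) : Prop :=
  [/\ bijective s,
      forall (f : fn_sym L) (x : 'I_(fn_arity f) -> M),
        s (fn_interp x) = fn_interp (fun i => s (x i))
    & forall (r : rel_sym L) (x : 'I_(rel_arity r) -> M),
        rel_interp (fun i => s (x i)) <-> rel_interp x].

Definition strongly_homogeneous (K : Type) (L : language) (M : structure L) :
    Prop :=
  forall (I : Type) (a b : I -> M),
    small K [set: I] -> tp a set0 = tp b set0 ->
    exists2 s : M -> M, automorphism s & forall i, s (a i) = b i.

(* kappa-saturated and strongly kappa-homogeneous, with kappa > |L| + aleph_0. *)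
Definition monster (K : Type) (L : language) (T : theory L) (M : structure L) :
    Prop :=
  [/\ models M T,
      small K [set: nat] /\ small K [set: fn_sym L + rel_sym L],
      saturated K M
    & strongly_homogeneous K M].

Definition indiscernible (L : language) (M : structure L) (A : set M) (n : nat)
    (b : nat -> 'I_n -> M) : Prop :=
  forall (k : nat) (s t : 'I_k -> nat),
    {homo s : i j / i < j} -> {homo t : i j / i < j} ->
    tp (fun p : 'I_k * 'I_n => b (s p.1) p.2) A =
    tp (fun p : 'I_k * 'I_n => b (t p.1) p.2) A.

Definition divides (L : language) (M : structure L) (X : Type) (A : set M)
    (phi : pformula M X) : Prop :=
  exists b : nat -> 'I_(plen phi) -> M,
    [/\ indiscernible A b,
        forall i, tp (b i) A = tp (ppar phi) A
      & ~ exists x : X -> M, forall i, psat x (PFormula (pform phi) (b i))].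

Definition formula_forks (L : language) (M : structure L) (X : Type) (A : set M)
    (phi : pformula M X) : Prop :=
  exists (k : nat) (psi : 'I_k -> pformula M X),
    (forall i, divides A (psi i)) /\
    forall x : X -> M, psat x phi -> exists i, psat x (psi i).

(* Implication is tested in [M], which by saturation is harmless for partial
   types with a small set of parameters in a small tuple of variables. *)
Definition forks (L : language) (M : structure L) (X : Type) (A : set M)
    (p : set (pformula M X)) : Prop :=
  exists2 phi : pformula M X,
    (forall x : X -> M, realizes x p -> psat x phi) & formula_forks A phi.

Definition fork_indep (L : language) (M : structure L) (A : set M) (I J : Type)
    (a : I -> M) (b : J -> M) : Prop :=
  ~ forks A (tp a (A `|` range b)).

Definition BS_trivial_over (K M : Type) (A : set M)
    (indep : set M -> forall I J : Type, (I -> M) -> (J -> M) -> Prop) : Prop :=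
  forall (I J : Type) (a : I -> M) (b : J -> M) (c : M),
    small K [set: I] -> small K [set: J] ->
    indep A J I b a ->
    indep A (J + unit)%type I (tcat b (singleton c)) a \/
    indep A J (I + unit)%type b (tcat a (singleton c)).

(* Main.v *)
Require Import Defs.
From mathcomp Require Import all_boot.
From mathcomp Require Import boolp classical_sets functions cardinality filter.
From mathcomp Require Import zify.

Set Implicit Arguments.
Unset Strict Implicit.
Unset Printing Implicit Defensive.

Local Open Scope classical_set_scope.
Local Open Scope card_scope.

(** Suppose that [b] is independent from [a] over [A], but that [bc] forks with
    [a] and [b] forks with [ac]. The failure is turned into a formula with the
    independence property in a unary expansion of a model of [T].

    Since tp(b/Aa) does not fork over [A], it is contained in an ultrafilter [D]
    on the space of tuples of [M] that contains no set defined by a formula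
    dividing over [A] ([not_forks_ultrafilter]); [D] plays the part of a global
    non-forking extension. The type of [bc] over [Aa] implies a finite
    disjunction of formulas dividing over [A]. Replace [b] by a realization of
    [D] over [Aa] and over the parameters of these formulas, and move [c] along
    with it: now [bc] satisfies a single formula phi(y,z;e) which divides over
    [A], while [b] is still [D]-generic over [Aae]. On the other side, by
    compactness, [b] satisfies a formula R(y;d,c) with [d] in [Aa] which forks
    over [A]; it is therefore not in [D].

    The sequence witnessing that phi(y,z;e) divides extends to an
    [A]-indiscernible sequence g_0, g_1, ... of tuples g_i = (d_i,e_i) with
    g_0 = (d,e) ([extend_indiscernible]). By NIP, [D] cannot distinguish the
    sequence from its shifts over [A], since a formula distinguishing two of its
    blocks would divide ([ultrafilter_shift]). Now let [b] realize [D] over the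
    whole sequence. The formulas phi(y,z;e_i) are inconsistent, so that after
    thinning out, phi(b,c;e_i) holds for i = 0 only. For any [D]-generic b' over
    [A] and the sequence, (b',g_i,g_(i+1),...) is conjugate over [A] to
    (b,g_0,g_1,...); let c(b',i) be the corresponding image of [c]. Choose b_0,
    b_1, ... successively, each one realizing [D] over the sequence and over all
    previous c(b_j,i), and put c_ij = c(b_j,i). The conjunction theta of R and
    phi then satisfies
    - theta(b_j,g_i,c_ij) for all i, j;
    - not theta(b_j,g_k,c_ij) for k > i, because of phi;
    - not theta(b_l,g_i,c_ij) for l > j, because R(y;d_i,c_ij) forks and is
      not in [D].

    Such a half grid is impossible ([no_half_grid]). By Ramsey's theorem the
    truth of theta(b_l,g_k,c_ij) may be assumed to depend only on the relative
    order of i, j, k, l. Pairs of neighbours in the two sequences then satisfy a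
    Boolean combination theta' of instances of theta with c_ij exactly if they
    are the i-th and the j-th pair. If a unary predicate P names an arbitrary
    set of points c_ij, the formula asking for a z in P with theta' defines an
    arbitrary bipartite graph between the two sequences; the remaining
    compactness is provided by an ultrapower ([finite_IP]). *)

(** * Small cardinals *)

Definition inj_le (X Y : Type) : Prop := exists f : X -> Y, injective f.

Lemma inj_le_trans (X Y Z : Type) : inj_le X Y -> inj_le Y Z -> inj_le X Z.
Proof. by move=> [f fi] [g gi]; exists (g \o f); exact: inj_comp. Qed.

Lemma sval_inj (T : Type) (P : T -> Prop) (x y : {x | P x}) : sval x = sval y -> x = y.
Proof. by case: x y => [x Px] [y Py] /= e; exact: eq_exist. Qed.

Lemma card_le_inj_le (T U : Type) (A : set T) (B : set U) :
  (A #<= B) <-> inj_le {x | A x} {y | B y}.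
Proof.
split=> [/card_leP [f]|[f fi]].
  exists (fun x => let y := f (SigSub (mem_set (svalP x))) in
                   exist B (val y) (set_mem (valP y))).
  move=> -[x Ax] [y Ay] [] /= e; apply: eq_exist.
  have /val_inj/(inj (f := f)) := e.
  by rewrite !in_setT => /(_ isT isT) [].
apply/card_leP.
pose g (x : A) : B := let y := f (exist A (val x) (set_mem (valP x))) in
   SigSub (mem_set (svalP y)).
apply/injfunPex; exists g => // x y _ _ [] /= e; apply: val_inj => /=.
by have /fi [] := sval_inj e.
Qed.

Lemma smallE (K T : Type) (A : set T) :
  small K A <-> inj_le {x | A x} K /\ ~ inj_le K {x | A x}.
Proof.
have KT : inj_le K {x : K | [set: K] x} by exists (fun k => exist _ k I) => x y [].
have TK : inj_le {x : K | [set: K] x} K.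
  by exists sval => -[x ?] [y ?] /= e; apply: eq_exist.
rewrite /small /card_lt !card_le_inj_le; split=> -[h1 h2]; split.
- exact: inj_le_trans h1 TK.
- by move=> h; apply: h2; exact: inj_le_trans TK h.
- exact: inj_le_trans h1 KT.
- by move=> h; apply: h2; exact: inj_le_trans KT h.
Qed.

Definition small_type (K X : Type) : Prop := inj_le X K /\ ~ inj_le K X.

Lemma small_typeE (K X : Type) : small K [set: X] <-> small_type K X.
Proof.
have XT : inj_le X {x : X | [set: X] x} by exists (fun k => exist _ k I) => x y [].
have TX : inj_le {x : X | [set: X] x} X.
  by exists sval => -[x ?] [y ?] /= e; apply: eq_exist.
rewrite smallE; split=> -[h1 h2]; split.
- exact: inj_le_trans XT h1.
- by move=> h; apply: h2; exact: inj_le_trans h XT.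
- exact: inj_le_trans TX h1.
- by move=> h; apply: h2; exact: inj_le_trans h TX.
Qed.

Lemma small_type_inj (K X Y : Type) : inj_le X Y -> small_type K Y -> small_type K X.
Proof.
move=> XY [YK KY]; split; first exact: inj_le_trans XY YK.
by move=> KX; apply: KY; exact: inj_le_trans KX XY.
Qed.

Lemma surj_inj_le (X Y : Type) (f : X -> Y) : (forall y, exists x, f x = y) -> inj_le Y X.
Proof. by move=> /choice [g gK]; exists g; exact: can_inj gK. Qed.

Definition partial_bij (X Y : Type) (R : set (X * Y)) : Prop :=
  forall x y x' y', R (x, y) -> R (x', y') -> (x = x' <-> y = y').

Lemma partial_bij_bigcup (X Y : Type) (F : set (set (X * Y))) :
  (forall R, F R -> partial_bij R) -> total_on F subset ->
  partial_bij (\bigcup_(R in F) R).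
Proof.
move=> FP Ft x y x' y' [R FR Rxy] [S FS Sxy].
have [RS|SR] := Ft _ _ FR FS.
  exact: (FP _ FS) (RS _ Rxy) Sxy.
exact: (FP _ FR) Rxy (SR _ Sxy).
Qed.

(** Zorn: a maximal partial bijection exhausts one of the two types. *)
Lemma inj_le_total (X Y : Type) : inj_le X Y \/ inj_le Y X.
Proof.
have [|R [Rp Rmax]] := @Zorn_bigcup _ (@partial_bij X Y).
  by move=> F FP Ft; exact: partial_bij_bigcup.
have [Rx|/existsNP [x0 nx0]] := pselect (forall x, exists y, R (x, y)).
  left; move/choice: Rx => [f fR]; exists f => x x' e.
  by apply/(Rp _ _ _ _ (fR x) (fR x')).
right.
have Ry : forall y, exists x, R (x, y).
  move=> y0; apply: contrapT => ny0.
  apply: (Rmax (R `|` [set (x0, y0)])).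
    split; first by move=> p; left.
    move=> /(_ (x0, y0)) h; apply: nx0; exists y0; apply: h; right => //.
  move=> x y x' y' [h|[-> ->]] [h'|[-> ->]] //; first exact: Rp h h'.
    split=> e; first by case: nx0; exists y; rewrite -e.
    by case: ny0; exists x; rewrite -e.
  split=> e; first by case: nx0; exists y'; rewrite e.
  by case: ny0; exists x'; rewrite e.
move/choice: Ry => [f fR]; exists f => y y' e.
by apply/(Rp _ _ _ _ (fR y) (fR y')).
Qed.

Lemma inj_le_sum (X Y X' Y' : Type) :
  inj_le X X' -> inj_le Y Y' -> inj_le (X + Y) (X' + Y').
Proof.
move=> [f fi] [g gi].
exists (fun s => match s with inl x => inl (f x) | inr y => inr (g y) end).
by move=> [x|y] [x'|y'] // []; [move/fi ->|move/gi ->].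
Qed.

(** Hilbert's hotel along a sequence [g]: its points move to even positions and
    the odd ones receive [C]. *)
Lemma absorb_countable (Y C : Type) : inj_le nat Y -> inj_le C nat -> inj_le (Y + C) Y.
Proof.
move=> [g gi] [e ei].
have /choice [h hP] : forall y, exists z, (forall n, y = g n -> z = g n.*2) /\
    (~ (exists n, y = g n) -> z = y).
  move=> y; have [[n ->]|nn] := pselect (exists n, y = g n).
    by exists (g n.*2); split=> [m /gi -> //|[]]; exists n.
  by exists y; split=> // n e'; case: nn; exists n.
exists (fun s => match s with inl y => h y | inr c => g (e c).*2.+1 end).
have hE y : (exists2 n, y = g n & h y = g n.*2) \/ (~ (exists n, y = g n)) /\ h y = y.
  have [[n yn]|nn] := pselect (exists n, y = g n).
    by left; exists n => //; apply: (hP y).1.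
  by right; split => //; apply: (hP y).2.
move=> [y|c] [y'|c'].
- have [[n -> ->]|[n ->]] := hE y; have [[n' -> ->]|[n' ->]] := hE y'.
  + by move=> /gi /double_inj ->.
  + by move=> E; case: n'; exists n.*2.
  + by move=> E; case: n; exists n'.*2.
  + by move=> ->.
- have [[n _ ->]|[n ->]] := hE y; last by move=> E; case: n; exists (e c').*2.+1.
  by move=> /gi E; have := congr1 odd E; rewrite /= !odd_double.
- have [[n _ ->]|[n ->]] := hE y'; last by move=> E; case: n; exists (e c).*2.+1.
  by move=> /gi E; have := congr1 odd E; rewrite /= !odd_double.
- by move=> /gi [] /double_inj /ei ->.
Qed.

Lemma inj_le_nat_sum (X Y : Type) : inj_le nat (X + Y) -> inj_le nat X \/ inj_le nat Y.
Proof.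
move=> [f fi].
have key (Z : Type) (i : Z -> X + Y) : injective i ->
    infinite_set [set n | exists z, f n = i z] -> inj_le nat Z.
  move=> ii /infiniteP /card_le_inj_le h.
  have NT : inj_le nat {x : nat | [set: nat] x} by exists (fun k => exist _ k I) => x y [].
  apply: inj_le_trans NT (inj_le_trans h _).
  have /choice [r rP] : forall n : {n | exists z, f n = i z}, exists z, f (sval n) = i z.
    by case.
  exists r => n n' e; apply: sval_inj; apply: fi; by rewrite !rP e.
have [F1|] := pselect (finite_set [set n | exists z, f n = inl z]); last first.
  by move/key => h; left; apply: h => ? ? [].
right; apply: (@key _ inr) => [? ? []//|F2].
apply: (proj2 (infiniteP [set: nat]) (card_lexx _)).
have -> : [set: nat] = [set n | exists z, f n = inl z] `|` [set n | exists z, f n = inr z].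
  by apply/seteqP; split=> // n _; case E: (f n) => [x|y]; [left|right]; [exists x|exists y].
by rewrite finite_setU.
Qed.

(** By Zorn there is a maximal subset [S] of [Y] with a bijection onto two copies
    of itself. A sequence outside [S] could be added to it, so the complement
    of [S] is countable and is absorbed by [S]. *)
Lemma inj_le_double (Y : Type) : inj_le nat Y -> inj_le (Y + Y) Y.
Proof.
move=> natY.
pose P (R : set (Y * (Y * bool))) := partial_bij R /\ forall y b, (exists p, R (y, p)) <-> exists x, R (x, (y, b)).
have [|R [[Rp Rd] Rmax]] := @Zorn_bigcup _ P.
  move=> F FP Ft; split.
    by apply: partial_bij_bigcup => // R /FP [].
  move=> y b; split=> -[p [R FR Rp]].
    have /((FP _ FR).2 y b) [x Rx] : exists p, R (y, p) by exists p.
    by exists x, R.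
  have /((FP _ FR).2 y b) [q Rq] : exists x, R (x, (y, b)) by exists p.
  by exists q, R.
pose S := {y | exists p, R (y, p)}.
pose C := {y | ~ exists p, R (y, p)}.
have SS : inj_le (S + S) S.
  have /choice [f fP] : forall z : S * bool, exists x : S, R (sval x, (sval z.1, z.2)).
    move=> [[y yS] b] /=; have [x Rx] := (Rd y b).1 yS.
    have xS : exists p, R (x, p) by exists (y, b).
    by exists (exist _ x xS).
  exists (fun s => match s with inl y => f (y, false) | inr y => f (y, true) end).
  have fi z z' : f z = f z' -> z = z'.
    move: z z' => [z b] [z' b'] e.
    have := (Rp _ _ _ _ (fP (z, b)) (fP (z', b'))).1 (congr1 sval e).
    by move=> [] /sval_inj -> ->.
  by move=> [y|y] [y'|y'] /fi // [->].
have YSC : inj_le Y (S + C).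
  have /choice [f fP] : forall y, exists s : S + C,
      y = match s with inl s => sval s | inr s => sval s end.
    move=> y; have [h|h] := pselect (exists p, R (y, p)).
      by exists (inl (exist _ y h)).
    by exists (inr (exist _ y h)).
  by exists f => y y' e; rewrite (fP y) (fP y') e.
have Cfin : ~ inj_le nat C.
  move=> [g gi].
  pose gg n := sval (g n).
  have ggi n n' : gg n = gg n' -> n = n' by move/sval_inj/gi.
  have ggR n p : ~ R (gg n, p) by move=> h; apply: (svalP (g n)); exists p.
  have ggR' n x b : ~ R (x, (gg n, b)).
    move=> h; apply: (svalP (g n)); apply/(Rd _ b); by exists x.
  (* the sequence [gg] is matched with its double by splitting positions
     according to parity *)
  pose G := [set p : Y * (Y * bool) | exists n, p = (gg n, (gg n./2, odd n))].
  apply: (Rmax (R `|` G)).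
    split; first by move=> p; left.
    move=> /(_ (gg 0, (gg 0, false))) h; apply: (ggR 0 (gg 0, false)).
    by apply: h; right; exists 0.
  split.
    move=> x y x' y' [h|[n [-> ->]]] [h'|[n' [-> ->]]].
    - exact: Rp h h'.
    - by split=> e; [case: (ggR n' y); rewrite -e|case: (ggR' n'./2 x (odd n')); rewrite -e].
    - by split=> e; [case: (ggR n y'); rewrite e|case: (ggR' n./2 x' (odd n)); rewrite e].
    - split=> [/ggi -> //|[] /ggi e1 e2]; congr gg.
      by rewrite -(odd_double_half n) -(odd_double_half n') e1 e2.
  move=> y b; split=> [[p [h|[n [-> _]]]]|[x [h|[n [_ -> _]]]]].
  - have /(Rd y b) [x Rx] : exists p, R (y, p) by exists p.
    by exists x; left.
  - exists (gg (b + n.*2)); right; exists (b + n.*2).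
    by rewrite half_bit_double oddD odd_double addbF oddb.
  - have /(Rd y b) [q Rq] : exists x, R (x, (y, b)) by exists x.
    by exists q; left.
  - by exists (gg n./2./2, odd n./2); right; exists n./2.
have Cnat : inj_le C nat by have [] := inj_le_total C nat.
have natS : inj_le nat S.
  by have [] := inj_le_nat_sum (inj_le_trans natY YSC).
have SY : inj_le S Y by exists sval => x y /sval_inj.
apply: (inj_le_trans _ SY).
apply: (inj_le_trans (inj_le_sum YSC YSC)).
have SC : inj_le (S + C) S by exact: absorb_countable.
exact: inj_le_trans (inj_le_sum SC SC) SS.
Qed.

(** Parameter sets are unions such as [A `|` range a]. Of two infinite summands the
    larger one absorbs the other. *)
Lemma small_type_sum (K X Y : Type) : inj_le nat K ->
  small_type K X -> small_type K Y -> small_type K (X + Y).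
Proof.
move=> natK.
wlog : X Y / inj_le X Y.
  move=> H hX hY; have [XY|YX] := inj_le_total X Y; first exact: H.
  apply: (small_type_inj _ (H _ _ YX hY hX)).
  by exists (fun s => match s with inl x => inr x | inr y => inl y end) => -[x|x] [y|y] // [->].
move=> XY hX hY.
have [natY|] := pselect (inj_le nat Y).
  apply: small_type_inj hY; apply: inj_le_trans (inj_le_double natY).
  by apply: inj_le_sum => //; exists id.
move=> nY.
have nXY : ~ inj_le nat (X + Y).
  by move=> /inj_le_nat_sum [h|//]; apply: nY; exact: inj_le_trans h XY.
have [h|KXY] := inj_le_total nat (X + Y) => //.
split; first exact: inj_le_trans KXY natK.
by move=> h; apply: nXY; exact: inj_le_trans natK h.
Qed.

(** * Ultrafilters and recursively built sequences *)

Lemma filter_forall_finite (T I : Type) (F : set_system T) (q : set I) (A : I -> set T) :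
  Filter F -> finite_set q -> (forall i, q i -> F (A i)) ->
  F [set x | forall i, q i -> A i x].
Proof.
move=> FF qf qA.
have [D qD] := proj1 (@finite_fsetP {classic I} q) qf.
have := @filter_bigI T {classic I} D A F FF.
move=> h; apply: filterS (h _) => [x hx i qi|i iD]; last by apply: qA; rewrite qD.
by apply: (hx i); rewrite -qD.
Qed.

Lemma ultraNot (Z : Type) (D : set_system Z) (S : set Z) :
  UltraFilter D -> D (~` S) <-> ~ D S.
Proof.
move=> DU; split=> [Dn DS|nD]; last by have [//|] := in_ultra_setVsetC S DU.
apply: (@filter_not_empty _ D); apply: filterS (filterI DS Dn) => y [].
exact.
Qed.

Lemma ultraI (Z : Type) (D : set_system Z) (DU : UltraFilter D) (S S' : set Z) :
  D S -> D S' -> D (S `&` S').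
Proof. exact: filterI. Qed.

Lemma ultraS (Z : Type) (D : set_system Z) (DU : UltraFilter D) (S S' : set Z) :
  D S -> S `<=` S' -> D S'.
Proof. by move=> h SS'; apply: filterS h. Qed.

Lemma nonprincipal_ultrafilter : exists U : set_system nat,
  UltraFilter U /\ forall n, U [set i | n <= i].
Proof.
have [U [UU oU]] := ultraFilterLemma (F := \oo) _.
by exists U; split=> // n; apply: oU; exists n.
Qed.

Lemma ultra_all_ord (Z : Type) (U : set_system Z) (UU : UltraFilter U) (k : nat)
    (Q : 'I_k -> set Z) :
  (forall j, U (Q j)) -> U [set i | forall j, Q j i].
Proof.
move=> h; apply: ultraS (@filter_forall_finite _ _ U setT Q _ _ _) _ => //.
by move=> i Qi j; apply: Qi.
Qed.

(** Recursion in which each term is chosen depending on all previous ones. *)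
Lemma build_seq (X : Type) (P : seq X -> X -> Prop) :
  (forall s, exists x, P s x) -> exists h : nat -> X, forall n, P (mkseq h n) (h n).
Proof.
move=> /choice [g gP]; pose hist n := iter n (fun s => rcons s (g s)) [::].
exists (fun n => g (hist n)) => n.
have -> : mkseq (fun n => g (hist n)) n = hist n; last exact: gP.
by elim: n => //= n IH; rewrite mkseqS IH.
Qed.

Lemma increasing_subsequence (Q : nat -> Prop) : (forall N, exists2 i, N <= i & Q i) ->
  exists t : nat -> nat, {homo t : i j / i < j} /\ forall i, Q (t i).
Proof.
move=> h; have [s|t tP] := @build_seq nat (fun s x => all (fun y => y < x) s /\ Q x).
  have [x mx Qx] := h (\max_(y <- s) y).+1; exists x; split=> //.
  apply/allP => y ys; apply: leq_trans mx; rewrite ltnS.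
  exact: (@leq_bigmax_seq _ s xpredT id).
exists t; split=> [i j ij|i]; last exact: (tP i).2.
have /allP := (tP j).1; apply; apply/mapP; exists i => //.
by rewrite mem_iota add0n.
Qed.

(** * Formulas, definable sets and automorphisms *)
Section Formulas.
Variable L : language.

Fixpoint trename (V W : Type) (f : V -> W) (t : term L V) : term L W :=
  match t with
  | tvar x => tvar L (f x)
  | tapp g ts => tapp (fun i => trename f (ts i))
  end.

Fixpoint frename (V W : Type) (f : V -> W) (phi : formula L V) : formula L W :=
  match phi with
  | fbot => fbot
  | feq t u => feq (trename f t) (trename f u)
  | Defs.frel r ts => Defs.frel (fun i => trename f (ts i))
  | fimp phi psi => fimp (frename f phi) (frename f psi)
  | fall phi => fall (frename (omap f) phi)
  end.

Variable M : structure L.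

Lemma eval_rename (V W : Type) (f : V -> W) (v : W -> M) (t : term L V) :
  eval v (trename f t) = eval (v \o f) t.
Proof. by elim: t => //= g ts IH; congr fn_interp; apply/funext. Qed.

Lemma sat_rename (V W : Type) (f : V -> W) (v : W -> M) (phi : formula L V) :
  sat v (frename f phi) <-> sat (v \o f) phi.
Proof.
elim: phi W f v => {V} [V|V t u|V r ts|V phi IH psi IH'|V phi IH] W f v //=.
- by rewrite !eval_rename.
- by under eq_fun => i do rewrite eval_rename.
- by rewrite IH IH'.
- have E m : oapp v m \o omap f = oapp (v \o f) m by apply/funext => -[].
  by split=> h m; move: (h m); rewrite IH E.
Qed.

Definition fnot (V : Type) (phi : formula L V) := fimp phi fbot.
Definition fand (V : Type) (phi psi : formula L V) := fnot (fimp phi (fnot psi)).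
Definition fex (V : Type) (phi : formula L (option V)) := fnot (fall (fnot phi)).

Lemma sat_fand (V : Type) (v : V -> M) phi psi :
  sat v (fand phi psi) <-> sat v phi /\ sat v psi.
Proof.
split=> [/= h|[h h'] /=]; last by apply.
split; apply: contrapT => n; apply: h => // h h'; exact: n.
Qed.

Lemma sat_fex (V : Type) (v : V -> M) phi :
  sat v (fex phi) <-> exists m, sat (oapp v m) phi.
Proof.
split=> [/= h|[m h] /= /(_ m)]; last exact.
by apply: contrapT => n; apply: h => m h; apply: n; exists m.
Qed.

Lemma eval_supp (V : Type) (t : term L V) : exists s : set V, finite_set s /\
  forall v w : V -> M, (forall x, s x -> v x = w x) -> eval v t = eval w t.
Proof.
elim: t => [x|g ts IH]; first by exists [set x]; split=> [//|v w]; apply.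
have [s sP] := choice IH.
exists (\bigcup_i s i); split=> [|v w h].
  apply: bigcup_finite => [|i _]; [exact: finite_finset|exact: (sP i).1].
by congr fn_interp; apply/funext => i; apply: (sP i).2 => x sx; apply: h; exists i.
Qed.

(** A formula depends on finitely many of its variables only; this reduces the
    types in infinitely many variables, and with infinitely many parameters, to
    finite ones. *)
Lemma sat_supp (V : Type) (phi : formula L V) : exists s : set V, finite_set s /\
  forall v w : V -> M, (forall x, s x -> v x = w x) -> sat v phi -> sat w phi.
Proof.
elim: phi => {V} [V|V t u|V r ts|V phi [s [sf sP]] psi [s' [sf' sP']]|V phi [s [sf sP]]].
- by exists set0.
- have [s [sf sP]] := eval_supp t; have [s' [sf' sP']] := eval_supp u.
  exists (s `|` s'); split=> [|v w h /=]; first by rewrite finite_setU.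
  by rewrite (sP v w) ?(sP' v w) // => x sx; apply: h; [right|left].
- have [s sP] := choice (fun i => eval_supp (ts i)).
  exists (\bigcup_i s i); split=> [|v w h /=].
    apply: bigcup_finite => [|i _]; [exact: finite_finset|exact: (sP i).1].
  have -> // : (fun i => eval v (ts i)) = (fun i => eval w (ts i)).
  by apply/funext => i; apply: (sP i).2 => x sx; apply: h; exists i.
- exists (s `|` s'); split=> [|v w h /= i p]; first by rewrite finite_setU.
  apply: (sP' v w) => [x sx|]; first by apply: h; right.
  by apply: i; apply: (sP w v) => // x sx; rewrite h //; left.
- exists (Some @^-1` s); split=> [|v w h /= H m].
    by apply: finite_preimage => // x y _ _ [].
  by apply: sP (H m) => -[x|] //= sx; apply: h.
Qed.

(** The total map [r] allows one to rename all variables of a formula into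
    ['I_n], the values outside [s] being irrelevant by [sat_supp]. *)
Lemma finite_retract (V : Type) (s : set V) : finite_set s ->
  exists n (f : 'I_n -> V) (r : V -> 'I_n), forall x, s x -> f (r x) = x.
Proof.
move=> sf; have [[v0]|nV] := pselect (inhabited V); last first.
  have h (v : V) : False by apply: nV.
  have h0 (i : 'I_0) : V by case: i.
  exists 0, h0.
  by exists (fun v => match h v with end) => x; case: (h x).
have /finite_set_leP [n /card_le_inj_le [g gi]] : finite_set (s `|` [set v0]).
  by rewrite finite_setU.
have gn x : sval (g x) < n := svalP (g x).
have /choice [f fP] : forall i : 'I_n, exists v, forall x, sval (g x) = i -> v = sval x.
  move=> i; have [[x xi]|h] := pselect (exists x, sval (g x) = i).
    by exists (sval x) => y yi; congr sval; apply: gi; apply: sval_inj; rewrite xi yi.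
  by exists v0 => x xi; case: h; exists x.
have /choice [r rP] : forall v, exists i : 'I_n, s v -> f i = v.
  move=> v; have [sv|nsv] := pselect (s v).
    have sv' : (s `|` [set v0]) v by left.
    by exists (Ordinal (gn (exist _ v sv'))) => _; exact: (fP _ (exist _ v sv')).
  have sv' : (s `|` [set v0]) v0 by right.
  by exists (Ordinal (gn (exist _ v0 sv'))).
by exists n, f, r.
Qed.

(** Types are handled through the sets that they contain: a formula with
    parameters in [B] is replaced by the set it defines, so that no parameter
    tuples have to be carried along. *)
Definition def_over (B : set M) (X : Type) (S : set (X -> M)) : Prop :=
  exists phi : formula L (X + {m | B m}),
    forall x, S x <-> sat (tcat x sval) phi.

Lemma def_overI (B : set M) (X V : Type) (phi : formula L (X + V)) (v : V -> M)
    (S : set (X -> M)) :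
  (forall i, B (v i)) -> (forall x, S x <-> sat (tcat x v) phi) -> def_over B S.
Proof.
move=> vB h.
pose f (s : X + V) := match s with inl x => inl x | inr i => inr (exist _ (v i) (vB i)) end.
exists (frename f phi) => x; rewrite h sat_rename.
by have -> : tcat x sval \o f = tcat x v by apply/funext => -[].
Qed.

Lemma def_over_psat (B : set M) (X : Type) (p : pformula M X) :
  params_in B p -> def_over B (fun x => psat x p).
Proof. by move=> pB; apply: (@def_overI _ _ _ (pform p) (ppar p)). Qed.

Lemma def_over_pformula (B : set M) (X : Type) (S : set (X -> M)) :
  def_over B S -> exists p : pformula M X, params_in B p /\ forall x, psat x p <-> S x.
Proof.
move=> [phi phiP]; have [s [sf sP]] := sat_supp phi.
have [n [f [r fr]]] : exists n (f : 'I_n -> {m | B m}) (r : {m | B m} -> 'I_n),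
    forall b, s (inr b) -> f (r b) = b.
  apply: (@finite_retract _ (inr @^-1` s)).
  by apply: finite_preimage => // x y _ _ [].
pose g (z : X + {m | B m}) := match z with inl x => inl x | inr b => inr (r b) end.
exists (PFormula (frename g phi) (sval \o f)); split=> [i|x]; first exact: svalP.
rewrite /psat /= sat_rename phiP; split; apply: sP => -[x0|b] //= sb; by rewrite fr.
Qed.

(** [F] replaces each coordinate by a coordinate or by a parameter from [B']. This
    covers reindexing of variables and evaluation of some of them. *)
Lemma def_over_subst (B B' : set M) (X Y : Type) (F : (Y -> M) -> X -> M)
    (S : set (X -> M)) :
  B `<=` B' ->
  (forall x, (exists y0, forall y, F y x = y y0) \/
             (exists m, B' m /\ forall y, F y x = m)) ->
  def_over B S -> def_over B' (S \o F).
Proof.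
move=> BB' FP [phi phiP].
have /choice [h hP] : forall x, exists z : Y + {m | B' m},
    forall y, F y x = tcat y sval z.
  move=> x; have [[y0 e]|[m [Bm e]]] := FP x; first by exists (inl y0).
  by exists (inr (exist _ m Bm)).
pose g (z : X + {m | B m}) := match z with inl x => h x
  | inr b => inr (exist _ (sval b) (BB' _ (svalP b))) end.
exists (frename g phi) => y; rewrite /= phiP sat_rename.
by have -> : tcat (F y) sval = tcat y sval \o g by apply/funext => -[x|b] //=.
Qed.

Lemma def_over_sub (B B' : set M) (X : Type) (S : set (X -> M)) :
  B `<=` B' -> def_over B S -> def_over B' S.
Proof. by move=> BB'; apply: (def_over_subst (F := id)) => // x; left; exists x. Qed.

Lemma def_over_not (B : set M) (X : Type) (S : set (X -> M)) :
  def_over B S -> def_over B (~` S).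
Proof. by move=> [phi h]; exists (fnot phi) => x /=; rewrite -h. Qed.

Lemma def_over_and (B : set M) (X : Type) (S S' : set (X -> M)) :
  def_over B S -> def_over B S' -> def_over B (S `&` S').
Proof.
by move=> [phi h] [phi' h']; exists (fand phi phi') => x; rewrite sat_fand -h -h'.
Qed.

Definition same_type (B : set M) (X : Type) (x y : X -> M) : Prop :=
  forall S, def_over B S -> S x -> S y.

Lemma same_type_iff (B : set M) (X : Type) (x y : X -> M) S :
  same_type B x y -> def_over B S -> S x <-> S y.
Proof.
move=> h dS; split; first exact: h.
by move=> Sy; apply: contrapT => nSx; apply: (h _ (def_over_not dS) nSx).
Qed.

Lemma tp_same_type (B : set M) (X : Type) (x y : X -> M) :
  tp x B = tp y B <-> same_type B x y.
Proof.
split=> [e S dS Sx|h].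
  have [p [pB pS]] := def_over_pformula dS.
  have : tp x B p by split=> //; apply/pS.
  by rewrite e => -[_ /pS].
apply/seteqP; split=> p [pB px]; split=> //.
  exact: (h _ (def_over_psat pB)).
by apply/(same_type_iff h (def_over_psat pB)).
Qed.

Lemma same_type_reindex (B : set M) (X Y : Type) (f : Y -> X) (x y : X -> M) :
  same_type B x y -> same_type B (x \o f) (y \o f).
Proof.
move=> h S dS; apply: (h (fun z => S (z \o f))).
by apply: (def_over_subst (F := fun z => z \o f)) dS => // i; left; exists (f i).
Qed.

Definition aut_over (B : set M) (s : M -> M) : Prop :=
  automorphism s /\ forall m, B m -> s m = m.

Lemma eval_aut (s : M -> M) (V : Type) (v : V -> M) (t : term L V) :
  automorphism s -> eval (s \o v) t = s (eval v t).
Proof.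
move=> [_ sf _]; elim: t => //= g ts IH; rewrite sf; congr fn_interp; exact/funext.
Qed.

Lemma sat_aut (s : M -> M) (V : Type) (v : V -> M) (phi : formula L V) :
  automorphism s -> sat (s \o v) phi <-> sat v phi.
Proof.
move=> hs; have [[s' ss' s's] _ sr] := hs.
elim: phi v => {V} [V|V t u|V r ts|V phi IH psi IH'|V phi IH] v //=.
- by rewrite !eval_aut //; split=> [/(can_inj ss')|->].
- by under eq_fun => i do rewrite eval_aut //; rewrite sr.
- by rewrite IH IH'.
- have E m : oapp (s \o v) (s m) = s \o oapp v m by apply/funext => -[].
  split=> h m; first by have := h (s m); rewrite E IH.
  by rewrite -(s's m) E IH.
Qed.

Lemma aut_def (B : set M) (s : M -> M) (X : Type) (x : X -> M) (S : set (X -> M)) :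
  aut_over B s -> def_over B S -> S (s \o x) <-> S x.
Proof.
move=> [hs sB] [phi h]; rewrite !h -(sat_aut (tcat x sval) _ hs).
have -> // : s \o tcat x (@proj1_sig M (fun m => B m)) = tcat (s \o x) sval.
by apply/funext => -[i|[m Bm]] //=; exact: sB.
Qed.

Lemma aut_same_type (B : set M) (s : M -> M) (X : Type) (x : X -> M) :
  aut_over B s -> same_type B x (s \o x).
Proof. by move=> hs S dS Sx; apply/(aut_def _ hs dS). Qed.

Lemma aut_over_sub (B B' : set M) (s : M -> M) : B `<=` B' -> aut_over B' s -> aut_over B s.
Proof. by move=> BB' [h h']; split=> // m /BB' /h'. Qed.

End Formulas.

Lemma inj_le_countType (X : countType) : inj_le X nat.
Proof. by exists pickle; exact: pcan_inj (@pickleK X). Qed.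

(** * Saturation and homogeneity *)
Section Monster.
Variables (K : Type) (L : language) (T : theory L) (M : structure L).
Hypothesis hM : monster K T M.

Definition small_set (B : set M) : Prop := small_type K {m | B m}.

Lemma small_setE (B : set M) : small K B <-> small_set B.
Proof. exact: smallE. Qed.

Lemma small_type_nat : small_type K nat.
Proof. by case: hM => _ [/small_typeE ? _] _ _. Qed.

Lemma small_type_count (X : Type) : inj_le X nat -> small_type K X.
Proof. by move=> h; exact: small_type_inj h small_type_nat. Qed.

Lemma small_type_countType (X : countType) : small_type K X.
Proof. exact: small_type_count (inj_le_countType X). Qed.

Lemma small_type_plus (X Y : Type) :
  small_type K X -> small_type K Y -> small_type K (X + Y).
Proof. by apply: small_type_sum; case: small_type_nat. Qed.

Lemma small_set_sub (B B' : set M) : B `<=` B' -> small_set B' -> small_set B.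
Proof.
move=> BB'; apply: small_type_inj.
exists (fun x => exist _ (sval x) (BB' _ (svalP x))) => x y /(congr1 sval) /= e.
exact: sval_inj.
Qed.

Lemma small_set_range (X : Type) (f : X -> M) : small_type K X -> small_set (range f).
Proof.
apply: small_type_inj.
apply: (@surj_inj_le _ _ (fun x => exist _ (f x) (imageP f (I : [set: X] x)))).
by move=> [m p]; have [x _ e] := p; exists x; exact: sval_inj.
Qed.

Lemma small_set_setU (B B' : set M) : small_set B -> small_set B' -> small_set (B `|` B').
Proof.
move=> h h'; apply: small_type_inj (small_type_plus h h').
apply: (@surj_inj_le _ _ (fun s => match s with
  | inl x => exist _ (sval x) (or_introl (svalP x))
  | inr x => exist _ (sval x) (or_intror (svalP x)) end)).
by move=> [m [Bm|Bm]]; [exists (inl (exist _ m Bm))|exists (inr (exist _ m Bm))]; exact: sval_inj.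
Qed.

Lemma small_set_count (B : set M) (X : countType) (f : X -> M) :
  small_set B -> small_set (B `|` range f).
Proof. move=> h; apply: small_set_setU => //; apply/small_set_range/small_type_countType. Qed.

(** The parameters in [B] are appended to both tuples, so that the automorphism
    given by strong homogeneity over the empty set fixes them. *)
Lemma homogeneity (B : set M) (X : Type) (x y : X -> M) :
  small_set B -> small_type K X -> same_type B x y ->
  exists s, aut_over B s /\ forall i, s (x i) = y i.
Proof.
move=> sB sX xy; case: hM => _ _ _ hom.
have [|s hs e] := hom _ (tcat x (@proj1_sig M B)) (tcat y (@proj1_sig M B))
    (proj2 (small_typeE _ _) (small_type_plus sX sB)).
  apply/tp_same_type => S dS; apply: (xy (fun z => S (tcat z (@proj1_sig M B)))).
  apply: (def_over_subst (F := fun z => tcat z (@proj1_sig M B))) dS => //.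
  by move=> [i|[m Bm]]; [left; exists i|right; exists m].
exists s; split=> [|i]; last exact: (e (inl i)).
by split=> // m Bm; exact: (e (inr (exist _ m Bm))).
Qed.

(** A proper filter on the space of tuples is finitely satisfiable by definition;
    this is the form in which saturation is used. *)
Lemma realize (n : nat) (F : set_system ('I_n -> M)) (B : set M) :
  ProperFilter F -> small_set B ->
  exists x, forall S, def_over B S -> F S -> S x.
Proof.
move=> FF sB; case: hM => _ _ sat _.
pose p := [set phi : pformula M 'I_n | params_in B phi /\ F (fun x => psat x phi)].
have [|phi []|q qf qp|x xp] := sat B n p; rewrite ?small_setE //.
  have /filter_ex [x xq] : F [set x | forall phi, q phi -> psat x phi].
    by apply: filter_forall_finite => // phi /qp [].
  by exists x => phi /xq.
exists x => S dS FS; have [phi [phiB phiS]] := def_over_pformula dS.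
apply/phiS/xp; split=> //; apply: filterS FS => z; by rewrite phiS.
Qed.

End Monster.

(** * Forking *)
Section Forking.
Variables (L : language) (M : structure L).

Lemma realizes_tp (X : Type) (x y : X -> M) (B : set M) :
  realizes y (tp x B) <-> same_type B x y.
Proof.
split=> [h S dS Sx|h p [pB px]]; last exact: h _ (def_over_psat pB) px.
have [p [pB pS]] := def_over_pformula dS.
by apply/pS/h; split=> //; apply/pS.
Qed.

Definition prename (X Y : Type) (f : X -> Y) (p : pformula M X) : pformula M Y :=
  PFormula (frename (fun s => match s with inl x => inl (f x) | inr i => inr i end)
              (pform p)) (ppar p).

Lemma psat_prename (X Y : Type) (f : X -> Y) (p : pformula M X) (y : Y -> M) :
  psat y (prename f p) <-> psat (y \o f) p.
Proof.
rewrite /psat sat_rename.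
by have -> : tcat (y \o f) (ppar p) = tcat y (ppar p) \o
  (fun s => match s with inl x => inl (f x) | inr i => inr i end)
  by apply/funext => -[].
Qed.

Variable A : set M.

Lemma divides_prename (X Y : Type) (f : X -> Y) (p : pformula M X) :
  divides A p -> divides A (prename f p).
Proof.
move=> [b [b1 b2 b3]]; exists b; split=> // -[y yP]; apply: b3.
by exists (y \o f) => i; apply/(psat_prename f (PFormula (pform p) (b i))); exact: yP.
Qed.

Definition forks_set (X : Type) (S : set (X -> M)) : Prop :=
  exists (k : nat) (psi : 'I_k -> pformula M X),
    (forall i, divides A (psi i)) /\ forall x, S x -> exists i, psat x (psi i).

Lemma forks_reindex (X Y : Type) (f : Y -> X) (x : X -> M) (B : set M) :
  forks A (tp (x \o f) B) -> forks A (tp x B).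
Proof.
move=> [phi phiP [k [psi [psiD psiP]]]]; exists (prename f phi).
  move=> y /realizes_tp xy; apply/psat_prename/phiP/realizes_tp.
  exact: same_type_reindex.
exists k, (fun i => prename f (psi i)); split=> [i|y]; first exact: divides_prename.
by move=> /psat_prename /psiP [i h]; exists i; apply/psat_prename.
Qed.

(** The witnesses of division are sequences over [A], which also serve for the
    images of the parameters under an automorphism over [A]. *)
Lemma forks_set_aut (X : Type) (s : M -> M) (S S' : set (X -> M)) :
  aut_over A s -> (forall y, S' (s \o y) -> S y) -> forks_set S -> forks_set S'.
Proof.
move=> sA SS' [k [psi [psiD psiP]]].
exists k, (fun i => PFormula (pform (psi i)) (s \o ppar (psi i))); split=> [i|y S'y].
  have [b [b1 b2 b3]] := psiD i; exists b; split=> // j; rewrite b2.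
  apply/tp_same_type; exact: aut_same_type.
have [[[s' ss' s's] _ _] _] := sA.
have e : y = s \o (s' \o y) by apply/funext => j /=; rewrite s's.
have [|i h] := psiP (s' \o y); first by apply: SS'; rewrite -e.
exists i; rewrite e /psat /=.
have -> : tcat (s \o (s' \o y)) (s \o ppar (psi i)) = s \o tcat (s' \o y) (ppar (psi i)).
  by apply/funext => -[].
by apply/sat_aut => //; case: sA.
Qed.

Definition avoids_dividing (X : Type) (D : set_system (X -> M)) : Prop :=
  forall p : pformula M X, divides A p -> ~ D (fun x => psat x p).

(** If no set in the type of [x] over [B] is covered by finitely many dividing
    formulas, this type together with the complements of the dividing formulas
    generates a proper filter. *)
Lemma fork_dichotomy (X : Type) (x : X -> M) (B : set M) :
  (exists S, [/\ def_over B S, S x & forks_set S]) \/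
  (exists D : set_system (X -> M), [/\ UltraFilter D,
     forall S, def_over B S -> S x -> D S & avoids_dividing D]).
Proof.
have [?|nS] := pselect (exists S, [/\ def_over B S, S x & forks_set S]); first by left.
right.
pose F : set_system (X -> M) := [set S | exists S0 (k : nat) (psi : 'I_k -> pformula M X),
  [/\ def_over B S0, S0 x, forall i, divides A (psi i) &
      forall y, S0 y -> (forall i, ~ psat y (psi i)) -> S y]].
have h0 (Z : Type) (i : 'I_0) : Z by case: i.
have FF : ProperFilter F.
  apply: Build_ProperFilter.
    move=> [S0 [k [psi [dS Sx psiD psiP]]]]; apply: nS; exists S0; split=> //.
    exists k, psi; split=> // y Sy; apply: contrapT => ny; apply: (psiP y Sy) => i h.
    by apply: ny; exists i.
  split.
  - exists setT, 0, (h0 _); split=> // [|[]//].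
    exists (fimp fbot fbot) => y; split=> //= _; exact: id.
  - move=> S S' [S0 [k [psi [dS Sx psiD psiP]]]] [S0' [k' [psi' [dS' Sx' psiD' psiP']]]].
    exists (S0 `&` S0'), (k + k'), (fun i => match fintype.split i with inl j => psi j | inr j => psi' j end).
    split=> //; first exact: def_over_and.
      by move=> i; case: fintype.split.
    move=> y [Sy Sy'] h; split.
      by apply: psiP => // i; have := h (unsplit (inl i)); rewrite unsplitK.
    by apply: psiP' => // i; have := h (unsplit (inr i)); rewrite unsplitK.
  - move=> S S' SS' [S0 [k [psi [dS Sx psiD psiP]]]].
    by exists S0, k, psi; split=> // y Sy /(psiP _ Sy)/SS'.
have [D [DU FD]] := ultraFilterLemma FF; exists D; split=> //.
- move=> S dS Sx; apply: FD; exists S, 0, (h0 _); split=> // -[] //.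
- move=> p dp Dp.
  have : D (~` (fun x => psat x p)).
    apply: FD; exists setT, 1, (fun _ => p); split=> //; last by move=> y _ /(_ ord0).
    exists (fimp fbot fbot) => y; split=> //= _; exact: id.
  move=> Dn; apply: (@filter_not_empty _ D); apply: filterS (filterI Dp Dn).
  by move=> y [].
Qed.

Lemma avoids_forks_set (X : Type) (D : set_system (X -> M)) (S : set (X -> M)) :
  UltraFilter D -> avoids_dividing D -> forks_set S -> ~ D S.
Proof.
move=> DU Da [k [psi [psiD psiP]]] DS.
have : D [set x | forall i, [set: 'I_k] i -> ~ psat x (psi i)].
  apply: filter_forall_finite => [|i _]; first exact: finite_finset.
  apply/(@ultraNot _ _ (fun x => psat x (psi i))) => //; exact: Da.
move=> Dn; apply: (@filter_not_empty _ D); apply: filterS (filterI DS Dn) => y [Sy h].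
by have [i] := psiP y Sy; exact: (h i I).
Qed.

(** The ultrafilter is a global extension of tp(x/B) that does not fork over
    [A]. *)
Lemma not_forks_ultrafilter (X : Type) (x : X -> M) (B : set M) :
  ~ forks A (tp x B) -> exists D : set_system (X -> M), [/\ UltraFilter D,
     forall S, def_over B S -> S x -> D S & avoids_dividing D].
Proof.
move=> nf; have [[S [dS Sx [k [psi [psiD psiP]]]]]|//] := fork_dichotomy x B.
case: nf; have [p [pB pS]] := def_over_pformula dS; exists p.
  by move=> y; apply; split=> //; apply/pS.
by exists k, psi; split=> // y /pS /psiP.
Qed.

Variables (K : Type) (T : theory L).
Hypothesis hM : monster K T M.

(** Forking is witnessed by a formula, hence by the finitely many coordinates
    occurring in it. A realization of the type of these coordinates extends to
    one of the whole type by homogeneity. *)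
Lemma forks_finite (X : Type) (x : X -> M) (B : set M) :
  small_set K B -> forks A (tp x B) -> exists s : set X, finite_set s /\
  forall (Y : Type) (f : Y -> X) (r : X -> Y), small_type K Y ->
    (forall i, s i -> f (r i) = i) -> forks A (tp (x \o f) B).
Proof.
move=> sB [phi phiP [k [psi [psiD psiP]]]].
have [s [sf sP]] := sat_supp M (pform phi).
exists (inl @^-1` s); split.
  by apply: finite_preimage => // i j _ _ [].
move=> Y f r sY fr; exists (prename r phi); last first.
  exists k, (fun i => prename r (psi i)); split=> [i|y]; first exact: divides_prename.
  by move=> /psat_prename /psiP [i h]; exists i; apply/psat_prename.
move=> y /realizes_tp /(homogeneity hM sB sY) [u [uB ue]].
have : psat (u \o x) phi by apply/phiP/realizes_tp; exact: aut_same_type uB.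
move=> h; apply/psat_prename; move: h; rewrite /psat; apply: sP => -[i si|i _] //=.
by rewrite -ue /= (fr _ si).
Qed.

(** Compactness: otherwise the ultrafilter of [fork_dichotomy] is realized over
    [B] and over the parameters of the dividing formulas, by a realization of
    tp(x/B) that satisfies none of them. *)
Lemma forks_formula (n : nat) (x : 'I_n -> M) (B : set M) :
  small_set K B -> forks A (tp x B) -> exists S, [/\ def_over B S, S x & forks_set S].
Proof.
move=> sB [phi phiP [k [psi [psiD psiP]]]].
have [//|[D [DU Dx Da]]] := fork_dichotomy x B.
pose e (z : {i : 'I_k & 'I_(plen (psi i))}) := ppar (psi (tag z)) (tagged z).
have sB' : small_set K (B `|` range e) by exact: (small_set_count hM).
have [y yP] := realize hM (F := D) _ sB'.
have [|i iP] := psiP y.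
  apply/phiP/realizes_tp => S dS Sx; apply: yP; last exact: Dx.
  by apply: def_over_sub dS => m; left.
exfalso; apply: (yP _ (def_over_not (@def_over_psat _ _ (B `|` range e) _ (psi i) _)) _) => //.
  by move=> j; right; exists (Tagged (fun i => 'I_(plen (psi i))) j).
by apply/ultraNot => //; exact: Da.
Qed.

End Forking.

(** * Ultrapowers and the independence property in unary expansions *)
Section Ultrapower.
Variables (L : language) (N : structure L) (U : set_system nat).
Hypothesis UU : UltraFilter U.

Definition eqU (f g : nat -> N) : Prop := U [set i | f i = g i].

Definition ultrapower_carrier := {C : set (nat -> N) | exists f, C = eqU f}.

Definition cls (f : nat -> N) : ultrapower_carrier := exist _ (eqU f) (ex_intro _ f erefl).

Lemma cls_eq (f g : nat -> N) : cls f = cls g <-> eqU f g.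
Proof.
split=> [/(congr1 sval)/= e|h].
  by rewrite e /eqU; apply: filterS filterT.
apply: sval_inj; apply/funext => k; apply/propext; split=> h'.
  by apply: filterS (filterI h h') => i [/= -> ->].
by apply: filterS (filterI h h') => i [/= -> ->].
Qed.

Lemma cls_surj (c : ultrapower_carrier) : exists f, cls f = c.
Proof. by case: c => C [f e]; exists f; apply: sval_inj. Qed.

Definition rep (c : ultrapower_carrier) : nat -> N := sval (cid (cls_surj c)).

Lemma repK (c : ultrapower_carrier) : cls (rep c) = c.
Proof. exact: svalP (cid (cls_surj c)). Qed.

Lemma rep_cls (f : nat -> N) : U [set i | rep (cls f) i = f i].
Proof. by apply/cls_eq; rewrite repK. Qed.

Definition ultrapower : structure L :=
  @Structure L ultrapower_carrier
    (match carrier_inhabited N with inhabits n => inhabits (cls (fun _ => n)) end)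
    (fun f x => cls (fun i => fn_interp (fun j => rep (x j) i)))
    (fun r x => U [set i | rel_interp (fun j => rep (x j) i)]).

Lemma eval_ultrapower (V : Type) (v : V -> ultrapower) (t : term L V) :
  U [set i | rep (eval v t) i = eval (fun x => rep (v x) i) t].
Proof.
elim: t => [x|f ts IH] /=; first by apply: filterS filterT.
pose g i := fn_interp (fun j => rep (eval v (ts j)) i).
apply: filterS (filterI (rep_cls g) (ultra_all_ord UU IH)) => i [/= e h].
rewrite e; by congr fn_interp; apply/funext.
Qed.

(** Los's theorem. *)
Theorem sat_ultrapower (V : Type) (v : V -> ultrapower) (phi : formula L V) :
  sat v phi <-> U [set i | sat (fun x => rep (v x) i) phi].
Proof.
elim: phi v => {V} [V|V t u|V r ts|V phi IH psi IH'|V phi IH] v /=.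
- split=> // h; exact: (@filter_not_empty _ U _ h).
- rewrite -[eval v t]repK -[eval v u]repK cls_eq /eqU.
  have h := ultraI UU (eval_ultrapower v t) (eval_ultrapower v u).
  by split=> h'; apply: (ultraS UU (ultraI UU h h')) => i [[/= <- <-]].
- have h := ultra_all_ord UU (fun j => eval_ultrapower v (ts j)).
  split=> h'; apply: (ultraS UU (ultraI UU h h')) => i [/= e].
    by under eq_fun => j do rewrite e.
  by under [in X in _ -> X]eq_fun => j do rewrite e.
- rewrite IH IH'; split=> [h|h h'].
    have [h'|h'] := in_ultra_setVsetC [set i | sat (fun x => rep (v x) i) phi] UU.
      by apply: (ultraS UU (h h')) => i hi _.
    by apply: (ultraS UU h') => i /= n /n.
  by apply: (ultraS UU (ultraI UU h h')) => i [/= e /e].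
- have E m i : (fun x => rep (oapp v m x) i) = oapp (fun x => rep (v x) i) (rep m i).
    by apply/funext => -[].
  split=> h; last first.
    by move=> m; apply/IH; apply: (ultraS UU h) => i /(_ (rep m i)); rewrite /= E.
  apply: contrapT => /(ultraNot _ UU) h'.
  have /choice [f fP] : forall i, exists n,
      ~ (forall n, sat (oapp (fun x => rep (v x) i) n) phi) ->
      ~ sat (oapp (fun x => rep (v x) i) n) phi.
    move=> i; have [e|/existsNP [n e]] := pselect (forall n, sat (oapp (fun x => rep (v x) i) n) phi).
      by case: (carrier_inhabited N) => n; exists n.
    by exists n.
  have /IH h2 := h (cls f).
  apply: (@filter_not_empty _ U); apply: (ultraS UU (ultraI UU (ultraI UU h' h2) (rep_cls f))) => i.
  by move=> [[/= /fP e1 e2] e3]; apply: e1; rewrite E e3 in e2.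
Qed.

Lemma ultrapower_models_Th : models ultrapower (Th N).
Proof.
move=> phi Nphi; apply/sat_ultrapower; apply: filterS filterT => i _ /=.
by have -> : (fun x => rep (of_void ultrapower x) i) = of_void N by apply/funext; case.
Qed.

End Ultrapower.

(** Shattering of all initial segments of the sequence [a] suffices: in a
    non-principal ultrapower the class of the tuples [b k S], as [k] varies, cuts
    out exactly [S]. *)
Lemma finite_IP (L : language) (N : structure L) (n m : nat)
    (phi : formula L ('I_n + 'I_m)) (a : nat -> 'I_n -> N)
    (b : nat -> set nat -> 'I_m -> N) :
  (forall k i (S : set nat), i < k -> sat (tcat (a i) (b k S)) phi <-> S i) ->
  has_IP (Th N) phi.
Proof.
move=> h; have [U [UU Uoo]] := nonprincipal_ultrafilter.
exists (ultrapower N U), (fun i x => cls U (fun _ => a i x)),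
  (fun S x => cls U (fun k => b k S x)).
split; first exact: ultrapower_models_Th.
move=> i S; rewrite sat_ultrapower.
set v := tcat _ _.
have e1 : U [set k | forall x, rep (cls U (fun _ => a i x)) k = a i x].
  by apply: (ultra_all_ord UU) => x; exact: rep_cls.
have e2 : U [set k | forall x, rep (cls U (fun k => b k S x)) k = b k S x].
  by apply: (ultra_all_ord UU) => x; exact: rep_cls.
have e3 k : [set k | forall x, rep (cls U (fun _ => a i x)) k = a i x] k ->
    [set k | forall x, rep (cls U (fun k => b k S x)) k = b k S x] k ->
    (fun x => rep (v x) k) = tcat (a i) (b k S).
  by move=> h1 h2; apply/funext => -[x|x] /=.
have e := ultraI UU (ultraI UU e1 e2) (Uoo i.+1).
split=> [H|Si].
  have [k [[[h1 h2] ik]]] := filter_ex (ultraI UU e H).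
  by rewrite /= (e3 k) // => /(h _ _ _ ik).
by apply: (ultraS UU e) => k [[h1 h2] ik] /=; rewrite (e3 k) //; apply/h.
Qed.

Section Embed.
Variables (L : language) (P : Type).

Fixpoint tembed (V : Type) (t : term L V) : term (monadic_language L P) V :=
  match t with
  | tvar x => tvar (monadic_language L P) x
  | tapp f ts => @tapp (monadic_language L P) V f (fun i => tembed (ts i))
  end.

Fixpoint fembed (V : Type) (phi : formula L V) : formula (monadic_language L P) V :=
  match phi with
  | fbot => fbot
  | feq t u => feq (tembed t) (tembed u)
  | Defs.frel r ts => @Defs.frel (monadic_language L P) V (inl r) (fun i => tembed (ts i))
  | fimp phi psi => fimp (fembed phi) (fembed psi)
  | fall phi => fall (fembed phi)
  end.

Variables (M : structure L) (U : P -> set M).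

Lemma eval_embed (V : Type) (v : V -> M) (t : term L V) :
  @eval _ (monadic_expansion U) _ v (tembed t) = eval v t.
Proof. by elim: t => //= f ts IH; congr fn_interp; apply/funext. Qed.

Lemma sat_embed (V : Type) (v : V -> M) (phi : formula L V) :
  @sat _ (monadic_expansion U) _ v (fembed phi) <-> sat v phi.
Proof.
elim: phi v => {V} [V|V t u|V r ts|V phi IH psi IH'|V phi IH] v //=.
- by rewrite !eval_embed.
- by under eq_fun => i do rewrite eval_embed.
- by rewrite IH IH'.
- by split=> h m; apply/IH.
Qed.

Definition fpred (V : Type) (p : P) (x : V) : formula (monadic_language L P) V :=
  @Defs.frel (monadic_language L P) V (inr p) (fun _ => tvar _ x).

End Embed.

Section MonadicNIP.
Variables (L : language) (T : theory L) (M : structure L).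
Hypotheses (MT : models M T) (hnip : monadically_NIP T).

(** Independence property with an additional element [z] ranging over an
    arbitrary subset of the model: the subset is named by a unary predicate and
    [z] is quantified away. *)
Lemma monadic_no_coding (X Y : finType) (theta : formula L (option (X + Y)))
    (P : set M) (a : nat -> X -> M) (b : nat -> set nat -> Y -> M) :
  ~ (forall k i (S : set nat), i < k ->
      (exists2 z, P z & sat (oapp (tcat (a i) (b k S)) z) theta) <-> S i).
Proof.
move=> h; pose U (_ : unit) := P.
pose f (z : option (X + Y)) : option ('I_#|X| + 'I_#|Y|) :=
  omap (fun s => match s with inl x => inl (enum_rank x) | inr y => inr (enum_rank y) end) z.
pose phi := fex (fand (fpred L tt None) (fembed unit (frename f theta))).
apply: (@hnip M unit U MT _ _ phi).
apply: (@finite_IP _ (monadic_expansion U) _ _ phi (fun i => a i \o enum_val)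
  (fun k S => b k S \o enum_val)) => k i S ik.
rewrite sat_fex -(h k i S ik); split=> -[z].
  rewrite sat_fand /= => -[Pz]; rewrite sat_embed sat_rename => hz; exists z => //.
  move: hz; set v := (X in sat X); set w := (X in _ -> sat X _).
  have -> // : v = w.
  by apply/funext => -[[x|y]|] //; rewrite /v /w /= enum_rankK.
move=> Pz hz; exists z; rewrite sat_fand /=; split=> //.
rewrite sat_embed sat_rename.
move: hz; set v := (X in sat X); set w := (X in _ -> sat X _).
have -> // : v = w.
by apply/funext => -[[x|y]|] //; rewrite /v /w /= enum_rankK.
Qed.

(** The case in which [z] does not occur: [T] itself is NIP. *)
Lemma no_IP (X Y : finType) (theta : formula L (X + Y))
    (a : nat -> X -> M) (b : set nat -> Y -> M) :
  ~ (forall i (S : set nat), sat (tcat (a i) (b S)) theta <-> S i).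
Proof.
move=> h; apply: (@monadic_no_coding X Y (frename Some theta) setT a (fun _ => b)).
move=> k i S _; rewrite -h; split=> [[z _]|hs]; first by rewrite sat_rename.
by case: (carrier_inhabited M) => z; exists z => //; rewrite sat_rename.
Qed.

End MonadicNIP.

(** * Ramsey's theorem and the impossibility of a half grid *)
Lemma sorted_subseq_iota (s : seq nat) (n : nat) :
  sorted ltn s -> all (fun x => x < n) s -> subseq s (iota 0 n).
Proof.
move=> ss sn; have -> : s = seq.filter (mem s) (iota 0 n); last exact: filter_subseq.
apply: (irr_sorted_eq ltn_trans ltnn ss).
  by apply: sorted_filter (iota_ltn_sorted 0 n); exact: ltn_trans.
move=> x; rewrite mem_filter /= mem_iota add0n /= andb_idr //.
by move=> /(allP sn).
Qed.

(** [lim f r s] is the value of [R f] on extensions of [s] by [r] points chosen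
    generically for a non-principal ultrafilter. Choosing each [h n] such that it
    preserves these values for all sequences of earlier points makes the value
    at every increasing sequence equal to [lim f (k f) [::]]. *)
Lemma ramsey (F : finType) (k : F -> nat) (R : F -> seq nat -> Prop) :
  exists (h : nat -> nat) (c : F -> Prop), {homo h : x y / x < y} /\
  forall f s, sorted ltn s -> size s = k f -> R f (map h s) <-> c f.
Proof.
have [U [UU Uoo]] := nonprincipal_ultrafilter.
pose lim f := fix lim r s : Prop := match r with
  | 0 => R f s
  | r.+1 => U [set x | lim r (rcons s x)] end.
pose G s f := [set x | lim f (k f - size s).-1 (rcons s x) <-> lim f (k f - size s).-1.+1 s].
have UG s f : U (G s f).
  have [h|h] := pselect (lim f (k f - size s).-1.+1 s).
    by apply: (ultraS UU h) => x.
  have /(ultraNot _ UU) h' := h.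
  by apply: (ultraS UU h') => x.
have [h hP] : exists h : nat -> nat, forall n, all (fun x => x < h n) (mkseq h n) /\
    forall s f, subseq s (mkseq h n) -> G s f (h n).
  apply: (@build_seq _ (fun t x => all (fun y => y < x) t /\
    forall s f, subseq s t -> G s f x)) => t.
  have U1 : U [set x | forall p : (size t).-tuple bool * F, [set: _] p -> G (mask p.1 t) p.2 x].
    by apply: filter_forall_finite => // p _; exact: UG.
  have [x [h1 h2]] := filter_ex (ultraI UU U1 (Uoo (\max_(y <- t) y).+1)).
  exists x; split.
    apply/allP => y yt; apply: leq_trans h2; rewrite ltnS.
    exact: (@leq_bigmax_seq _ t xpredT id).
  move=> s f /subseqP [m /eqP sm ->]; exact: (h1 (Tuple sm, f)).
have hmono : {homo h : x y / x < y}.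
  move=> x y xy; have /allP := (hP y).1; apply; apply/mapP; exists x => //.
  by rewrite mem_iota add0n.
exists h, (fun f => lim f (k f) [::]); split=> // f s ss sk.
have key : forall t, sorted ltn t -> size t <= k f ->
    lim f (k f - size t) (map h t) <-> lim f (k f) [::].
  move=> t; elim/last_ind: t => [|t y IH]; first by rewrite subn0.
  rewrite size_rcons => st tk.
  have st' : sorted ltn t.
    by apply: (subseq_sorted ltn_trans _ st); exact: subseq_rcons.
  have ty : all (fun x => x < y) t.
    by move: st; rewrite (sorted_pairwise ltn_trans) pairwise_rcons => /andP [].
  have [_ /(_ (map h t) f)] := hP y.
  have sub : subseq (map h t) (mkseq h y) by apply/map_subseq/sorted_subseq_iota.
  move=> /(_ sub); rewrite /G /= size_map map_rcons subnS => ->.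
  have E : 0 < k f - size t by rewrite subn_gt0.
  by rewrite -(IH st' (ltnW tk)) -[in X in _ <-> X](prednK E).
by have := key s ss; rewrite sk subnn => /(_ (leqnn _)).
Qed.

Section Shift.
Variable T : nat -> nat -> nat -> nat -> Prop.

Definition bump_at (v x : nat) := if x == v then v.+1 else x.

(** An index [v] may be moved up by one if this changes neither the relative
    order nor the coincidences of the four indices. The relations to which
    [ramsey] is applied list how the indices sit in their increasing
    enumeration. *)
Lemma ramsey_shift : exists h : nat -> nat, {homo h : x y / x < y} /\
  forall i j k l v, v \in [:: i; j; k; l] -> v.+1 \notin [:: i; j; k; l] ->
    T (h i) (h j) (h k) (h l) <->
    T (h (bump_at v i)) (h (bump_at v j)) (h (bump_at v k)) (h (bump_at v l)).
Proof.
pose F : finType := ('I_5 * ('I_4 * 'I_4 * 'I_4 * 'I_4))%type.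
pose R (f : F) s := let: (p0, p1, p2, p3) := f.2 in
  T (nth 0 s p0) (nth 0 s p1) (nth 0 s p2) (nth 0 s p3).
have [h [c [hm hP]]] := ramsey (fun f : F => f.1 : nat) R.
exists h; split=> // i j k l v vw vw'.
pose w := [:: i; j; k; l].
pose u := sort leq (undup w).
have uw : u =i w by move=> x; rewrite mem_sort mem_undup.
have us : sorted ltn u.
  by rewrite ltn_sorted_uniq_leq sort_uniq undup_uniq; exact: sort_sorted leq_total _.
have u4 : size u <= 4 by rewrite size_sort; exact: size_undup.
have ui x : x \in w -> index x u < size u by rewrite index_mem uw.
have ub : sorted ltn (map (bump_at v) u).
  apply: (@homo_sorted_in _ _ (mem u) (bump_at v) ltn ltn _ _ _ us); last by apply/allP.
  move=> x y xu yu /= xy; rewrite /bump_at.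
  have yv : y != v.+1 by apply: contraNneq vw' => <-; rewrite -/w -uw.
  case: eqP => [xv|_]; case: eqP => [yv'|_] //.
  - by rewrite xv yv' ltnn in xy.
  - by rewrite ltn_neqAle eq_sym yv -xv.
  - by rewrite -yv' ltnS ltnW.
pose f : F := (inord (size u), (inord (index i u), inord (index j u), inord (index k u), inord (index l u))).
have fk : f.1 = size u :> nat by rewrite /= inordK.
have H1 := hP f u us (esym fk).
have H2 := hP f (map (bump_at v) u) ub; rewrite size_map in H2; have {}H2 := H2 (esym fk).
have E1 x : x \in w -> nth 0 (map h u) (inord (n' := 3) (index x u)) = h x.
  by move=> xw; rewrite inordK ?(leq_trans (ui _ xw)) // (nth_map 0) ?ui // nth_index // uw.
have E2 x : x \in w -> nth 0 (map h (map (bump_at v) u)) (inord (n' := 3) (index x u)) = h (bump_at v x).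
  move=> xw; rewrite inordK ?(leq_trans (ui _ xw)) // -map_comp (nth_map 0) ?ui //=.
  by rewrite nth_index // uw.
have [iw jw kw lw] : [/\ i \in w, j \in w, k \in w & l \in w].
  by rewrite !inE !eqxx !orbT.
by move: H1 H2; rewrite /R /= !E1 // !E2 // => -> ->.
Qed.

End Shift.

(** Natural numbers code finite sets; the n-th finite set will be the
    neighbourhood of the n-th vertex on one side of a bipartite graph. *)
Lemma finite_code (k : nat) (S : set nat) :
  exists n, forall i, i < k -> (i \in odflt [::] (unpickle n)) <-> S i.
Proof.
exists (pickle [seq i <- iota 0 k | `[< S i >]]) => i ik.
by rewrite pickleK /= mem_filter mem_iota add0n ik /= andbT asboolE.
Qed.

Section Coding.
Variables (L : language) (T : theory L) (M : structure L).
Hypotheses (MT : models M T) (hnip : monadically_NIP T).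

(** Neighbouring pairs [gg i] and [bb j], taken at the homogeneous positions
    [4 i], [4 i + 1] and [4 j + 2], [4 j + 3], satisfy [theta'] with [c] at the
    positions [4 i], [4 j + 2]. If another pair satisfied it with the same [c],
    the two positions of this pair would have the same order relation to all
    others, and [theta] could not distinguish them. *)
Lemma no_half_grid (X Y : finType) (theta : formula L (option (X + Y)))
    (g : nat -> X -> M) (b : nat -> Y -> M) (c : nat -> nat -> M) :
  (forall i j, sat (oapp (tcat (g i) (b j)) (c i j)) theta) ->
  (forall i j l, j < l -> ~ sat (oapp (tcat (g i) (b l)) (c i j)) theta) ->
  (forall i j k, i < k -> ~ sat (oapp (tcat (g k) (b j)) (c i j)) theta) ->
  False.
Proof.
move=> h1 h2 h3.
have [h [hm hT]] := ramsey_shift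
  (fun i j k l => sat (oapp (tcat (g k) (b l)) (c i j)) theta).
pose ren (p q : bool) (z : option (X + Y)) : option ((X + X) + (Y + Y)) :=
  omap (fun s => match s with
    | inl x => inl (if p then inr x else inl x)
    | inr y => inr (if q then inr y else inl y) end) z.
pose theta' := fand (frename (ren false false) theta)
  (fand (fnot (frename (ren false true) theta)) (fnot (frename (ren true false) theta))).
pose gg i := tcat (g (h (4 * i))) (g (h (4 * i).+1)).
pose bb j := tcat (b (h (4 * j).+2)) (b (h (4 * j).+3)).
have theta'E i j z : sat (oapp (tcat (gg i) (bb j)) z) theta' <->
    [/\ sat (oapp (tcat (g (h (4 * i))) (b (h (4 * j).+2))) z) theta,
      ~ sat (oapp (tcat (g (h (4 * i))) (b (h (4 * j).+3))) z) theta &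
      ~ sat (oapp (tcat (g (h (4 * i).+1)) (b (h (4 * j).+2))) z) theta].
  have E p q : oapp (tcat (gg i) (bb j)) z \o ren p q =
      oapp (tcat (g (h (if p then (4 * i).+1 else 4 * i)))
        (b (h (if q then (4 * j).+3 else (4 * j).+2)))) z.
    by apply/funext => -[[x|y]|] //; case: p; case: q.
  rewrite !sat_fand /= !sat_rename !E /=.
  by split=> [[e1 [e2 e3]]|[e1 e2 e3]]; split.
pose P := [set z | exists i j, i \in odflt [::] (unpickle j) /\
  z = c (h (4 * i)) (h (4 * j).+2)].
have [code codeP] := choice (fun kS => finite_code kS.1 kS.2).
apply: (monadic_no_coding MT hnip (theta := theta') (P := P) (a := gg)
  (b := fun k S => bb (code (k, S)))) => k i S ik.
have cP : _ <-> S i := codeP (k, S) i ik.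
rewrite -cP; set j := code (k, S).
split=> [[z [i' [j' [ij ->]]] /theta'E [e1 e2 e3]]|ij].
  have bumpE v : bump_at v v = v.+1 by rewrite /bump_at eqxx.
  have bumpN v x : x != v -> bump_at v x = x by rewrite /bump_at => /negbTE ->.
  have ii : i' = i.
    apply: contrapT => ni; apply: e3.
    have := hT (4 * i') (4 * j').+2 (4 * i) (4 * j).+2 (4 * i).
    rewrite bumpE !bumpN; [|lia|lia|lia].
    by move=> H; apply/H; rewrite // !inE; lia.
  have jj : j' = j.
    apply: contrapT => nj; apply: e2.
    have := hT (4 * i') (4 * j').+2 (4 * i) (4 * j).+2 (4 * j).+2.
    rewrite bumpE !bumpN; [|lia|lia|lia].
    by move=> H; apply/H; rewrite // !inE; lia.
  by rewrite -ii -jj.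
exists (c (h (4 * i)) (h (4 * j).+2)); first by exists i, j.
apply/theta'E; split; first exact: h1.
  by apply: h2; apply: hm.
by apply: h3; apply: hm.
Qed.

End Coding.

(** * Indiscernible sequences and NIP *)
Section AutGroup.
Variables (L : language) (M : structure L) (A : set M).

Lemma aut_over_comp (s t : M -> M) : aut_over A s -> aut_over A t -> aut_over A (s \o t).
Proof.
move=> [[sb sf sr] sA] [[tb tf tr] tA]; split; last by move=> m Am /=; rewrite tA ?sA.
split=> [|f x|r x]; first exact: bij_comp.
  by rewrite /= tf sf.
by rewrite sr tr.
Qed.

Lemma aut_over_inv (s : M -> M) : aut_over A s ->
  exists s', [/\ aut_over A s', cancel s s' & cancel s' s].
Proof.
move=> [[[s' ss' s's] sf sr] sA]; exists s'; split=> //; split.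
  split=> [|f x|r x]; first by exists s.
    rewrite -[RHS]ss' sf; congr (s' (fn_interp _)); apply/funext => i /=; by rewrite s's.
  rewrite -sr.
  by have -> : (fun i => s (s' (x i))) = x by apply/funext => i; rewrite s's.
by move=> m Am; rewrite -{1}(sA m Am) ss'.
Qed.

End AutGroup.

Section Params.
Variables (L : language) (M : structure L).

Lemma def_over_supp (B : set M) (X : Type) (S : set (X -> M)) : def_over B S ->
  exists s : set X, finite_set s /\
    forall x y : X -> M, (forall i, s i -> x i = y i) -> S x -> S y.
Proof.
move=> [phi phiP]; have [s [sf sP]] := sat_supp M phi.
exists (inl @^-1` s); split; first by apply: finite_preimage => // i j _ _ [].
move=> x y xy; rewrite !phiP; apply: sP => -[i si|i _] //=; exact: xy.
Qed.

(** Finitely many of the coordinates in [Z] and of the parameters in [B] occur.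
    The index map [f] does not depend on the values [z], hence the same formula
    serves for a whole sequence of values. *)
Lemma def_over_params (B : set M) (X Z : Type) (S : set (X + Z -> M)) : def_over B S ->
  exists n (theta : formula L (X + 'I_n)) (f : 'I_n -> Z + {m | B m}),
    forall x z, S (tcat x z) <-> sat (tcat x (tcat z sval \o f)) theta.
Proof.
move=> [phi phiP]; have [s [sf sP]] := sat_supp M phi.
pose i (w : Z + {m | B m}) : (X + Z) + {m | B m} :=
  match w with inl z => inl (inr z) | inr b => inr b end.
have [n [f [r fr]]] : exists n (f : 'I_n -> Z + {m | B m}) (r : Z + {m | B m} -> 'I_n),
    forall w, s (i w) -> f (r w) = w.
  apply: (@finite_retract _ (i @^-1` s)).
  by apply: finite_preimage => // -[x|x] [y|y] _ _ // [->].
pose ren (w : (X + Z) + {m | B m}) : X + 'I_n := match w with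
  | inl (inl x) => inl x
  | inl (inr z) => inr (r (inl z))
  | inr b => inr (r (inr b)) end.
exists n, (frename ren phi), f => x z; rewrite phiP sat_rename.
by split; apply: sP => -[[x0|z0]|b] //= sw; rewrite ?(fr (inl z0) sw) ?(fr (inr b) sw).
Qed.

Lemma finite_bound (X : Type) (s : set (nat * X)) : finite_set s ->
  exists N, forall p, s p -> p.1 < N.
Proof.
move=> /(finite_image fst) /finite_seqP [t tE].
exists (\max_(y <- t) y).+1 => p sp; rewrite ltnS.
apply: (@leq_bigmax_seq _ t xpredT id) => //.
by have : (fst @` s) p.1 by [exists p]; rewrite tE.
Qed.

End Params.

Section Indisc.
Variables (K : Type) (L : language) (T : theory L) (M : structure L).
Hypothesis hM : monster K T M.
Variable A : set M.
Hypothesis sA : small_set K A.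

(** Over a small set, indiscernibility of a sequence in a homogeneous model can be
    expressed by automorphisms matching infinite subsequences, which avoids all
    syntax; see [indiscernible_aut]. *)
Definition aut_indiscernible (X : Type) (g : nat -> X -> M) : Prop :=
  forall s t : nat -> nat, {homo s : i j / i < j} -> {homo t : i j / i < j} ->
  exists2 u, aut_over A u & forall i x, u (g (s i) x) = g (t i) x.

Lemma same_type_finite_support (X : Type) (x y : nat * X -> M) :
  (forall N S, def_over A S ->
    (forall v w, (forall p, p.1 < N -> v p = w p) -> S v -> S w) -> S x -> S y) ->
  same_type A x y.
Proof.
move=> h S dS; have [s [/finite_bound [N Ns] sP]] := def_over_supp dS.
by apply: (h N S dS) => v w vw; apply: sP => p /Ns; exact: vw.
Qed.

Lemma indiscernible_aut (n : nat) (g : nat -> 'I_n -> M) :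
  indiscernible A g <-> aut_indiscernible g.
Proof.
split=> [h s t hs ht|h k s t hs ht].
  have [||u [uA ue]] := @homogeneity _ _ _ _ hM A (nat * 'I_n)%type
      (fun p => g (s p.1) p.2) (fun p => g (t p.1) p.2) sA.
  - exact: small_type_countType hM _.
  - apply: same_type_finite_support => N S dS SN.
    have /tp_same_type H := h N.+1 (fun i => s i) (fun i => t i)
      (fun i j ij => hs _ _ ij) (fun i j ij => ht _ _ ij).
    pose F (z : 'I_N.+1 * 'I_n -> M) (p : nat * 'I_n) := z (inord p.1, p.2).
    have dF : def_over A (S \o F).
      by apply: def_over_subst dS => // p; left; exists (inord p.1, p.2).
    move=> Sx; have := H _ dF => /= H'.
    by apply: (SN _ _ _ (H' (SN _ _ _ Sx))) => p pN; rewrite /F /= inordK // ltnW.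
  - by exists u => // i x; exact: (ue (i, x)).
pose ext (r : 'I_k -> nat) (i : nat) :=
  if insub i is Some j then r j else (\max_(j < k) r j).+1 + i.
have ext_homo (r : 'I_k -> nat) : {homo r : i j / i < j} -> {homo ext r : i j / i < j}.
  move=> hr i j ij; rewrite /ext.
  case: (insubP 'I_k j) => [j' jk jE|jk].
    rewrite insubT; first exact: ltn_trans ij jk.
    by move=> ik; apply: hr; rewrite /= jE.
  case: insubP => [i' ik iE|ik]; last by rewrite ltn_add2l.
  by rewrite addSn ltnS; apply: leq_trans (leq_addr _ _); exact: leq_bigmax.
have extE r (i : 'I_k) : ext r i = r i.
  by rewrite /ext valK.
have [u uA ue] := h _ _ (ext_homo s hs) (ext_homo t ht).
apply/tp_same_type.
have -> : (fun p : 'I_k * 'I_n => g (t p.1) p.2) = u \o (fun p : 'I_k * 'I_n => g (s p.1) p.2).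
  by apply/funext => p /=; rewrite -(extE s) -(extE t) ue.
exact: aut_same_type uA.
Qed.

Lemma aut_indiscernible_comp (X : Type) (g : nat -> X -> M) (r : nat -> nat) :
  {homo r : i j / i < j} -> aut_indiscernible g -> aut_indiscernible (g \o r).
Proof.
by move=> hr h s t hs ht; have [||u uA ue] := h (r \o s) (r \o t);
  [move=> i j /hs /hr|move=> i j /ht /hr|exists u].
Qed.

Lemma homo_id_shift (n : nat) : {homo (fun i => n + i) : i j / i < j}.
Proof. by move=> i j; rewrite ltn_add2l. Qed.

Lemma divides_aut_indiscernible (X : Type) (p : pformula M X) : divides A p ->
  exists eps : nat -> 'I_(plen p) -> M, [/\ aut_indiscernible eps,
    forall i, same_type A (ppar p) (eps i) &
    ~ exists x : X -> M, forall i, sat (tcat x (eps i)) (pform p)].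
Proof.
move=> [b [/indiscernible_aut b1 b2 b3]]; exists b; split=> // i.
by apply/tp_same_type; rewrite b2.
Qed.

(** The blocks of length [N] are moved by [s], each one being kept intact. *)
Lemma homo_block (N : nat) (s : nat -> nat) : 0 < N -> {homo s : i j / i < j} ->
  {homo (fun i => N * s (i %/ N) + i %% N) : i j / i < j}.
Proof.
move=> N0 hs i j ij.
have [e|ne] := eqVneq (i %/ N) (j %/ N).
  by rewrite e ltn_add2l; move: ij; rewrite {1}(divn_eq i N) {1}(divn_eq j N) e ltn_add2l.
have lt : i %/ N < j %/ N by rewrite ltn_neqAle ne leq_div2r // ltnW.
apply: leq_trans (leq_addr _ _); apply: leq_trans (leq_mul (leqnn N) (hs _ _ lt)).
by rewrite mulnS addnC ltn_add2r ltn_mod.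
Qed.

(** The blocks of length [N] of an indiscernible sequence form an indiscernible
    sequence, which witnesses division of the formula about the first block. *)
Lemma divides_block (X Y : Type) (g : nat -> X -> M) (N : nat)
    (S : set (Y + nat * X -> M)) :
  aut_indiscernible g -> 0 < N -> def_over A S ->
  (forall y v w, (forall p, p.1 < N -> v p = w p) -> S (tcat y v) -> S (tcat y w)) ->
  ~ (exists y, forall r, S (tcat y (fun p => g (N * r + p.1) p.2))) ->
  exists2 p : pformula M Y, divides A p &
    forall y, psat y p <-> S (tcat y (fun p => g p.1 p.2)).
Proof.
move=> hg N0 dS SN inc.
have [n [theta [f thetaP]]] := def_over_params dS.
(* the residue keeps the coordinates of [v r] inside the r-th block, even those on
   which [S] does not depend *)
pose v r (p : nat * X) := g (N * r + p.1 %% N) p.2.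
pose e r := tcat (v r) (@proj1_sig M (fun m => A m)) \o f.
have vE r y : S (tcat y (v r)) <-> S (tcat y (fun p => g (N * r + p.1) p.2)).
  by split; apply: SN => p pN; rewrite /v modn_small.
have eI : aut_indiscernible e.
  move=> s t hs ht; have [u uA ue] := hg _ _ (homo_block N0 hs) (homo_block N0 ht).
  exists u => // i x; rewrite /e /=; case: (f x) => [p|m] /=; last first.
    by case: uA => _; apply; exact: svalP.
  have := ue (N * i + p.1 %% N) p.2.
  by rewrite [N * i]mulnC divnMDl // divn_small ?ltn_mod // addn0 modnMDl modn_mod.
exists (PFormula theta (e 0)) => [|y]; last first.
  rewrite /psat /= -thetaP vE; by under eq_fun => p do rewrite muln0 add0n.
exists e; split.
- exact/indiscernible_aut.
- move=> i; have [||u uA ue] := eI (fun j => 0 + j) (fun j => i + j); try exact: homo_id_shift.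
  have := ue 0; rewrite !addn0 => {}ue.
  apply/esym/tp_same_type.
  have -> : e i = u \o e 0 by apply/funext => x; rewrite /= ue.
  exact: aut_same_type uA.
- move=> [y yP]; apply: inc; exists y => r; apply/vE; rewrite thetaP; exact: yP.
Qed.

Hypotheses (MT : models M T) (hnip : monadically_NIP T).

(** Given an alternating [y], any set [Z] of naturals can be prescribed as the set
    of those blocks that satisfy [S]: choose from each pair of neighbouring blocks
    the one with the desired truth value and move the chosen ones to the initial
    blocks by an automorphism over [A]. *)
Lemma no_alternation (X : Type) (Y : finType) (g : nat -> X -> M) (N : nat)
    (S : set (Y + nat * X -> M)) :
  aut_indiscernible g -> 0 < N -> def_over A S ->
  (forall y v w, (forall p, p.1 < N -> v p = w p) -> S (tcat y v) -> S (tcat y w)) ->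
  ~ exists y, forall r, S (tcat y (fun p => g (N * (2 * r) + p.1) p.2)) /\
                        ~ S (tcat y (fun p => g (N * (2 * r).+1 + p.1) p.2)).
Proof.
move=> hg N0 dS SN [y yP].
have [n [theta [f thetaP]]] := def_over_params dS.
pose s (Z : set nat) k := if `[< Z k >] then 2 * k else (2 * k).+1.
have sh Z : {homo s Z : i j / i < j}.
  by move=> i j ij; rewrite /s; case: asboolP; case: asboolP; lia.
have /choice [u uP] : forall Z : set nat, exists u, aut_over A u /\
    forall k q x, q < N -> u (g (N * s Z k + q) x) = g (N * k + q) x.
  move=> Z; have [|u uA ue] := hg _ id (homo_block N0 (@sh Z)); first by [].
  exists u; split=> // k q x qN; have := ue (N * k + q) x.
  by rewrite [N * k]mulnC divnMDl // divn_small // addn0 modnMDl modn_small // [k * N]mulnC.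
pose swap (z : Y + 'I_n) : 'I_n + Y := match z with inl i => inr i | inr i => inl i end.
apply: (no_IP MT hnip (theta := frename swap theta)
  (a := fun k => tcat (fun p => g (N * k + p.1) p.2) (@proj1_sig M (fun m => A m)) \o f)
  (b := fun Z => u Z \o y)) => k Z.
rewrite sat_rename.
set w := (X in sat X).
have -> : w = tcat (u Z \o y) (tcat (fun p => g (N * k + p.1) p.2) (@proj1_sig M (fun m => A m)) \o f).
  by apply/funext => -[].
rewrite -thetaP.
have E : S (tcat (u Z \o y) (fun p => g (N * k + p.1) p.2)) <->
    S (tcat y (fun p => g (N * s Z k + p.1) p.2)).
  rewrite -(aut_def (tcat y (fun p => g (N * s Z k + p.1) p.2)) (uP Z).1 dS).
  have -> : u Z \o tcat y (fun p => g (N * s Z k + p.1) p.2) =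
      tcat (u Z \o y) (fun p => u Z (g (N * s Z k + p.1) p.2)) by apply/funext => -[].
  by split; apply: SN => p pN; rewrite (uP Z).2.
rewrite E /s; case: asboolP => Zk; split=> //; first by move=> _; exact: (yP k).1.
by move/(yP k).2.
Qed.

(** A set distinguishing the first block from the second one cannot be in [D]: by
    [no_alternation] it would divide over [A]. For a shift by less than the
    length of the blocks, both sequences are compared with a third one that lies
    beyond the support of [S]. *)
Lemma ultrafilter_shift (X : Type) (Y : finType) (D : set_system (Y -> M)) (g : nat -> X -> M)
    (S : set (Y + nat * X -> M)) (n : nat) :
  UltraFilter D -> avoids_dividing A D -> aut_indiscernible g -> def_over A S ->
  D (fun y => S (tcat y (fun p => g p.1 p.2))) ->
  D (fun y => S (tcat y (fun p => g (n + p.1) p.2))).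
Proof.
move=> DU Da hg.
have block S' N : 0 < N -> def_over A S' ->
    (forall y v w, (forall p, p.1 < N -> v p = w p) -> S' (tcat y v) -> S' (tcat y w)) ->
    D (fun y => S' (tcat y (fun p => g p.1 p.2))) ->
    D (fun y => S' (tcat y (fun p => g (N + p.1) p.2))).
  move=> N0 dS' S'N D0; apply: contrapT => /(ultraNot _ DU) D1.
  pose F (z : Y + nat * X -> M) (w : Y + nat * X) := match w with
    | inl i => z (inl i) | inr p => z (inr (N + p.1, p.2)) end.
  have FE y v : F (tcat y v) = tcat y (fun p => v (N + p.1, p.2)).
    by apply/funext => -[].
  pose S2 := S' `&` ~` (S' \o F).
  have dS2 : def_over A S2.
    apply: def_over_and => //; apply: def_over_not; apply: def_over_subst dS' => // -[i|p].
      by left; exists (inl i).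
    by left; exists (inr (N + p.1, p.2)).
  have [|||p pD pP] := @divides_block X Y g (2 * N) S2 hg _ dS2.
  - by rewrite muln_gt0.
  - move=> y v w vw [S'v nS'v]; split; first by apply: S'N S'v => p pN; apply: vw; lia.
    move=> /= S'w; apply: nS'v; move: S'w; rewrite /= !FE; apply: S'N => p pN.
    by rewrite vw //=; lia.
  - move=> [y yP]; apply: (no_alternation hg N0 dS' S'N); exists y => r.
    have [y1 y2] := yP r; split.
      by apply: S'N y1 => p _; congr g; lia.
    move=> y3; apply: y2; rewrite /= FE; apply: S'N y3 => p _; congr g => /=; lia.
  - apply: (Da p pD); apply: (ultraS DU (ultraI DU D0 D1)) => y [y1 y2].
    by apply/pP; split=> //; rewrite /= FE.
move=> dS D0.
have [s0 [s0f s0P]] := def_over_supp dS.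
have [N Ns] : exists N, forall p, s0 (inr p) -> p.1 < N.
  apply: (@finite_bound _ (inr @^-1` s0)).
  by apply: finite_preimage => // p q _ _ [].
have SN y v w : (forall p, p.1 < N -> v p = w p) -> S (tcat y v) -> S (tcat y w).
  by move=> vw; apply: s0P => -[i _|p /Ns] //=; exact: vw.
have blocki S' N' : 0 < N' -> def_over A S' ->
    (forall y v w, (forall p, p.1 < N' -> v p = w p) -> S' (tcat y v) -> S' (tcat y w)) ->
    D (fun y => S' (tcat y (fun p => g (N' + p.1) p.2))) ->
    D (fun y => S' (tcat y (fun p => g p.1 p.2))).
  move=> N0 dS' S'N D1; apply: contrapT => /(ultraNot _ DU) D0'.
  have S'N' y v w : (forall p, p.1 < N' -> v p = w p) ->
      (~` S') (tcat y v) -> (~` S') (tcat y w).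
    by move=> vw nv S'w; apply: nv; apply: S'N S'w => p /vw.
  have D2 := block (~` S') N' N0 (def_over_not dS') S'N' D0'.
  apply: (@filter_not_empty _ D); apply: (ultraS DU (ultraI DU D1 D2)) => y [].
  exact.
pose F (z : Y + nat * X -> M) (w : Y + nat * X) := match w with
  | inl i => z (inl i) | inr p => z (inr (n + p.1, p.2)) end.
have FE y v : F (tcat y v) = tcat y (fun p => v (n + p.1, p.2)) by apply/funext => -[].
have dSF : def_over A (S \o F).
  apply: def_over_subst dS => // -[i|p]; first by left; exists (inl i).
  by left; exists (inr (n + p.1, p.2)).
have [N1 N1N N1n] : exists2 N1, N + n < N1 & 0 < N1 by exists (N + n).+1.
have E2 : D (fun y => S (tcat y (fun p => g (N1 + n + p.1) p.2))).
  apply: (block S (N1 + n)) => //; first by lia.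
  by move=> y v w vw; apply: SN => p pN; apply: vw; lia.
have SFN y v w : (forall p, p.1 < N1 -> v p = w p) ->
    (S \o F) (tcat y v) -> (S \o F) (tcat y w).
  by move=> vw /=; rewrite !FE; apply: SN => p pN; rewrite vw //=; lia.
have E1 : D (fun y => (S \o F) (tcat y (fun p => g (N1 + p.1) p.2))).
  by apply: (ultraS DU E2) => y /=; rewrite FE; apply: SN => p _ /=; congr g; lia.
by apply: (ultraS DU (blocki (S \o F) N1 N1n dSF SFN E1)) => y /=; rewrite FE.
Qed.

End Indisc.

(** * Extending an indiscernible sequence to longer tuples *)
Section Extract.
Variables (K : Type) (L : language) (T : theory L) (M : structure L).
Hypothesis hM : monster K T M.

Lemma realize_fin (X : finType) (F : set_system (X -> M)) (B : set M) :
  ProperFilter F -> small_set K B ->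
  exists x, forall S, def_over B S -> F S -> S x.
Proof.
move=> FF sB.
pose r (y : 'I_#|X| -> M) : X -> M := y \o enum_rank.
have rr (x : X -> M) : r (x \o enum_val) = x by apply/funext => i; rewrite /r /= enum_rankK.
pose F' : set_system ('I_#|X| -> M) := [set S | F (fun x => S (x \o enum_val))].
have FF' : ProperFilter F'.
  split; first by move=> h; exact: (@filter_not_empty _ F _ h).
  split; first exact: (@filterT _ F).
    by move=> S S' h h'; exact: (filterI h h').
  by move=> S S' SS' h; apply: filterS h => x; exact: SS'.
have [y yP] := realize hM FF' sB.
exists (r y) => S dS FS; apply: (yP (fun y => S (r y))).
  by apply: (def_over_subst (F := r)) dS => // i; left; exists (enum_rank i).
have FS' : F (fun x => S (r (x \o enum_val))).
  by apply: filterS FS => x Sx; rewrite rr.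
exact: FS'.
Qed.

Lemma dividing_finite (X : finType) (n : nat) (phi : formula L (X + 'I_n))
    (eps : nat -> 'I_n -> M) :
  ~ (exists x : X -> M, forall i, sat (tcat x (eps i)) phi) ->
  exists k, ~ exists x : X -> M, forall i, i < k -> sat (tcat x (eps i)) phi.
Proof.
move=> inc; apply: contrapT => /forallNP h; apply: inc.
pose F : set_system (X -> M) := [set S | exists k,
  forall x, (forall i, i < k -> sat (tcat x (eps i)) phi) -> S x].
have FF : ProperFilter F.
  split; first by move=> [k kP]; apply: (h k) => -[x /kP].
  split; first by exists 0.
    move=> S S' [k kP] [k' kP']; exists (maxn k k') => x xP; split.
      by apply: kP => i ik; apply: xP; rewrite leq_max ik.
    by apply: kP' => i ik; apply: xP; rewrite leq_max ik orbT.
  by move=> S S' SS' [k kP]; exists k => x /kP /SS'.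
pose e (p : nat * 'I_n) := eps p.1 p.2.
have sB : small_set K (range e) by apply: small_set_range; exact: (small_type_countType hM).
have [x xP] := realize_fin FF sB.
exists x => i; apply: (xP (fun x => sat (tcat x (eps i)) phi)); last by exists i.+1 => y h'; apply: h'.
by apply: (@def_overI _ _ _ _ _ phi (eps i)) => // j; exists (i, j).
Qed.

(** [C] adds to the parameters, along with each term of the sequence, further
    elements determined by it. *)
Lemma build_realizations (X : finType) (D : set_system (X -> M)) (B : set M) (Y : countType)
    (C : (X -> M) -> Y -> M) :
  ProperFilter D -> small_set K B ->
  exists b : nat -> X -> M, forall j S,
    def_over (B `|` [set C (b p.1) p.2 | p in [set p : nat * Y | p.1 < j]]) S ->
    D S -> S (b j).
Proof.
move=> FD sB.
have [m0] := carrier_inhabited M; pose d0 : X -> M := fun _ => m0.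
have [b bP] := @build_seq (X -> M) (fun s x => forall S,
    def_over (B `|` range (fun p : nat * Y => C (nth d0 s p.1) p.2)) S -> D S -> S x)
  (fun s => realize_fin FD (small_set_count hM _ sB)).
exists b => j S dS; apply: bP; apply: def_over_sub dS => m [|[p pj <-]]; first by left.
by right; exists p => //; rewrite nth_mkseq.
Qed.

Variable A : set M.
Hypothesis sA : small_set K A.

Definition update (I : nat -> nat) (j i : nat) : nat -> nat := fun q => if q == j then i else I q.

(** The positions below [j] are filled by generic indices, those chosen for larger
    positions first. *)
Fixpoint iterated_limit (U : set_system nat) (W : (nat -> nat) -> Prop) (j : nat) (I : nat -> nat) : Prop :=
  match j with
  | 0 => W I
  | j.+1 => U [set i | iterated_limit U W j (update I j i)]
  end.

(** [g] is a Morley sequence of the average type of [h] along [U]: each term realizes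
    this type over [h] and over the previous terms. Eliminating the terms of [g]
    from the last one downwards expresses the type of any increasing subsequence
    by iterated limits, independently of the subsequence. *)
Lemma average_sequence (U : set_system nat) (UU : UltraFilter U) (X : finType)
    (h : nat -> X -> M) : exists g : nat -> X -> M,
  (forall s S N I, {homo s : i j / i < j} -> def_over A S ->
    (forall v w, (forall p, p.1 < N -> v p = w p) -> S v -> S w) ->
    S (fun p => g (s p.1) p.2) <-> iterated_limit U (fun I => S (fun p => h (I p.1) p.2)) N I) /\
  (forall S, def_over A S -> S (g 0) <-> U [set i | S (h i)]).
Proof.
pose D : set_system (X -> M) := [set S | U [set i | S (h i)]].
have FD : ProperFilter D.
  split; first by move=> hh; exact: (@filter_not_empty _ U _ hh).
  split; first exact: (@filterT _ U).
    by move=> S S' hh hh'; exact: (ultraI UU hh hh').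
  by move=> S S' SS' hh; apply: (ultraS UU hh) => i; exact: SS'.
pose hp (p : nat * X) := h p.1 p.2.
have sB : small_set K (A `|` range hp) by exact: (small_set_count hM).
have [g gP] := build_realizations (fun x => x) FD sB.
have gE j S : def_over (A `|` range hp `|` [set g p.1 p.2 | p in [set p : nat * X | p.1 < j]]) S ->
    S (g j) <-> U [set i | S (h i)].
  move=> dS; split; last exact: gP.
  move=> Sg; apply: contrapT => /(ultraNot _ UU) n.
  exact: (gP j (~` S) (def_over_not dS) n).
exists g; split=> [s S N I hs dS SN|S dS]; last first.
  by apply: gE; apply: def_over_sub dS => m Am; left; left.
have key j : forall I, S (fun p => if p.1 < j then g (s p.1) p.2 else h (I p.1) p.2) <->
    iterated_limit U (fun I => S (fun p => h (I p.1) p.2)) j I.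
  elim: j => [|j IH] {}I //=.
  pose F (z : X -> M) (p : nat * X) := if p.1 < j then g (s p.1) p.2
    else if p.1 == j then z p.2 else h (I p.1) p.2.
  have dF : def_over (A `|` range hp `|` [set g p.1 p.2 | p in [set p : nat * X | p.1 < s j]]) (S \o F).
    apply: def_over_subst dS => [m Am|p]; first by left; left.
    rewrite /F; case: ltnP => pj.
      by right; exists (g (s p.1) p.2); split=> //; right; exists (s p.1, p.2) => //=; exact: hs.
    case: eqP => pj'; first by left; exists p.2.
    by right; exists (h (I p.1) p.2); split=> //; left; right; exists (I p.1, p.2).
  have E1 : (fun p : nat * X => if p.1 < j.+1 then g (s p.1) p.2 else h (I p.1) p.2) = F (g (s j)).
    apply/funext => p; rewrite /F ltnS leq_eqVlt.
    by have [->|] := eqVneq p.1 j; rewrite ?ltnn //=.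
  rewrite E1 -[S _]/((S \o F) (g (s j))) (gE _ _ dF).
  have E2 i : (S \o F) (h i) <-> iterated_limit U (fun I => S (fun p => h (I p.1) p.2)) j (update I j i).
    rewrite -IH /=.
    have -> // : F (h i) = (fun p => if p.1 < j then g (s p.1) p.2 else h (update I j i p.1) p.2).
    by apply/funext => p; rewrite /F /update; case: ltnP => // _; case: eqP.
  by split=> hU; apply: (ultraS UU hU) => i /E2.
rewrite -key; split; apply: SN => p pN; by rewrite pN.
Qed.

(** Conjugate copies [v i (d, e)] of [(d, e)] over the terms of [eps] need not be
    indiscernible, but a Morley sequence of their average type is. Iterated limits
    choose the indices of later positions first, which makes them the smaller ones;
    hence the second components have the type of [eps] in reversed order. *)
Lemma extend_indiscernible (X : finType) (n : nat) (d : X -> M) (e : 'I_n -> M) (eps : nat -> 'I_n -> M) :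
  aut_indiscernible A eps -> (forall i, same_type A e (eps i)) ->
  exists g : nat -> X + 'I_n -> M, [/\ aut_indiscernible A g, g 0 = tcat d e &
    forall k, exists2 u, aut_over A u &
      forall (i : 'I_k) x, u (g i (inr x)) = eps (k.-1 - i) x].
Proof.
move=> epsI epsE; have [U [UU Uoo]] := nonprincipal_ultrafilter.
have /choice [v vP] : forall i, exists v, aut_over A v /\ forall x, v (e x) = eps i x.
  move=> i; apply: (homogeneity hM sA _ (epsE i)); exact: (small_type_countType hM).
pose h i := v i \o tcat d e.
have [g [gP g0]] := average_sequence UU h.
have gI : aut_indiscernible A g.
  move=> s t hs ht.
  have [||u [uA ue]] := @homogeneity _ _ _ _ hM A (nat * (X + 'I_n))%type
      (fun p => g (s p.1) p.2) (fun p => g (t p.1) p.2) sA.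
  - exact: (small_type_countType hM).
  - apply: same_type_finite_support => N S dS SN.
    by rewrite (gP s S N id) // (gP t S N id).
  - by exists u => // i x; exact: (ue (i, x)).
have [||w [wA we]] := @homogeneity _ _ _ _ hM A _ (g 0) (tcat d e) sA.
- exact: (small_type_countType hM).
- move=> S dS; rewrite g0 // => hU; have [i] := filter_ex hU.
  by move=> /(aut_def _ (vP i).1 dS).
have [w' [w'A ww' w'w]] := aut_over_inv wA.
exists (fun i => w \o g i); split.
- move=> s t hs ht; have [u uA ue] := gI s t hs ht; exists (w \o (u \o w')).
    by apply: aut_over_comp => //; exact: aut_over_comp.
  by move=> i x /=; rewrite ww' ue.
- exact/funext.
move=> k.
suff [u uA ue] : exists2 u, aut_over A u &
      forall (i : 'I_k) x, u (g i (inr x)) = eps (k.-1 - i) x.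
  exists (u \o w') => [|i x /=]; [exact: aut_over_comp|by rewrite ww' ue].
have [||u [uA ue]] := @homogeneity _ _ _ _ hM A ('I_k * 'I_n)%type
    (fun p => g p.1 (inr p.2)) (fun p => eps (k.-1 - p.1) p.2) sA.
- exact: (small_type_countType hM).
- move=> S0 dS0.
  have [k0|k0] := posnP k.
    have -> // : (fun p : 'I_k * 'I_n => g p.1 (inr p.2)) = (fun p => eps (k.-1 - p.1) p.2).
    by apply/funext => -[[i ik]]; exfalso; rewrite k0 in ik.
  pose F (z : nat * (X + 'I_n) -> M) (p : 'I_k * 'I_n) := z (p.1 : nat, inr p.2).
  have dF : def_over A (S0 \o F).
    by apply: def_over_subst dS0 => // p; left; exists (p.1 : nat, inr p.2).
  have FN (x y : nat * (X + 'I_n) -> M) : (forall p, p.1 < k -> x p = y p) -> (S0 \o F) x -> (S0 \o F) y.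
    by move=> xy /=; have -> // : F x = F y; apply/funext => p; apply: xy; exact: ltn_ord.
  set c := S0 (fun p : 'I_k * 'I_n => eps (k.-1 - p.1) p.2).
  have key j : j <= k -> forall I, (forall q q', j <= q -> q < q' -> q' < k -> I q' < I q) ->
      iterated_limit U (fun I => (S0 \o F) (fun p => h (I p.1) p.2)) j I <-> c.
    elim: j => [_|j IH jk] I hI /=.
      have hI' : {homo (fun i => if i < k then I (k.-1 - i) else I 0 + i) : i j / i < j}.
        move=> i j ij; case: (ltnP i k) => ik; case: (ltnP j k) => jk; try lia.
          by apply: hI; lia.
        have [->|] := eqVneq (k.-1 - i) 0; first by lia.
        by move=> n0; have := hI 0 (k.-1 - i) isT; lia.
      have [u uA ue] := epsI _ _ (fun i j ij => ij : id i < id j) hI'.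
      rewrite /c -(aut_def (fun p : 'I_k * 'I_n => eps (k.-1 - p.1) p.2) uA dS0).
      have -> // : u \o (fun p : 'I_k * 'I_n => eps (k.-1 - p.1) p.2) =
          F (fun p => h (I p.1) p.2).
      apply/funext => -[[i ik] x] /=; rewrite /F /= ue.
      have -> : k.-1 - i < k by lia.
      have -> : k.-1 - (k.-1 - i) = i by lia.
      by rewrite /h /= (vP _).2.
    have hU i : \max_(q < k) I q < i ->
        (iterated_limit U (fun I => (S0 \o F) (fun p => h (I p.1) p.2)) j (update I j i) <-> c).
      move=> mi; apply: IH; first exact: ltnW.
      move=> q q' jq qq' q'k; rewrite /update.
      have -> : (q' == j) = false by lia.
      case: eqP => [_|/eqP qj]; last by apply: hI => //; lia.
      by apply: leq_ltn_trans mi; exact: (@leq_bigmax _ (fun q : 'I_k => I q) (Ordinal q'k)).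
    split=> [h1|hc].
      by have [i [/hU hi /hi]] := filter_ex (ultraI UU (Uoo (\max_(q < k) I q).+1) h1).
    by apply: (ultraS UU (Uoo (\max_(q < k) I q).+1)) => i /hU hi; apply/hi.
  have := gP id (S0 \o F) k id (fun i j ij => ij) dF FN.
  rewrite key // => [H|q q' kq qq' q'k]; last by lia.
  by move=> hS; apply/H.
- by exists u => // i x; exact: (ue (i, x)).
Qed.

End Extract.

(** * The half grid obtained from forking on both sides *)
Section Core.
Variables (K : Type) (L : language) (T : theory L) (M : structure L).
Hypotheses (hM : monster K T M) (hnip : monadically_NIP T).
Variable A : set M.
Hypothesis sA : small_set K A.

Let MT : models M T. Proof. by case: hM. Qed.

Lemma realized_iff (X : Type) (D : set_system (X -> M)) (B : set M) (x : X -> M) S :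
  UltraFilter D -> (forall S, def_over B S -> D S -> S x) -> def_over B S -> D S <-> S x.
Proof.
move=> DU xP dS; split; first exact: xP.
move=> Sx; apply: contrapT => /(ultraNot _ DU) nS.
exact: xP (def_over_not dS) nS Sx.
Qed.

Variables (m n : nat) (X : finType) (D : set_system ('I_m -> M)).
Hypotheses (DU : UltraFilter D) (Da : avoids_dividing A D).
Variables (phi : formula L (('I_m + unit) + 'I_n)) (R : set ('I_m + (X + unit) -> M)).
Hypothesis dR : def_over set0 R.

(** The half grid is built here: [phi], which divides, excludes the tuples of the
    sequence that come later, and [R], which forks, excludes the later generic
    realizations of [D]. *)
Lemma no_two_sided_forking (d : X -> M) (e : 'I_n -> M) (b : 'I_m -> M) (c : M) :
  divides A (PFormula phi e) ->
  (forall S, def_over (A `|` range (tcat d e)) S -> D S -> S b) ->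
  R (tcat b (tcat d (singleton c))) ->
  forks_set A (fun y => R (tcat y (tcat d (singleton c)))) ->
  sat (tcat (tcat b (singleton c)) e) phi -> False.
Proof.
move=> /(divides_aut_indiscernible hM sA) [eps [epsI epsE inc]] bD Rb Rf phib.
have [k kinc] := @dividing_finite _ _ _ _ hM ('I_m + unit)%type n phi eps inc.
have [g [gI g0 gE]] := extend_indiscernible hM sA d epsI epsE.
pose ge i := g i \o inr.
pose gd i := g i \o inl.
have ginc : ~ exists y : 'I_m + unit -> M, forall i, sat (tcat y (ge i)) phi.
  move=> [y yP]; have [u uA ue] := gE k; apply: kinc; exists (u \o y) => i ik.
  have k1 : k.-1 - i < k by lia.
  have := yP (Ordinal k1); rewrite -(sat_aut _ _ uA.1).
  have -> // : u \o tcat y (ge (Ordinal k1)) = tcat (u \o y) (eps i).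
  apply/funext => -[z|x] //=; rewrite /ge /= (ue (Ordinal k1)) /=.
  by congr (eps _ _); lia.
have sAg (g' : nat -> X + 'I_n -> M) : small_set K (A `|` range (fun p : nat * (X + 'I_n) => g' p.1 p.2)).
  exact: (small_set_count hM).
have [b1 b1D] := realize hM (F := D) _ (sAg g).
have sAde : small_set K (A `|` range (tcat d e)) by exact: (small_set_count hM).
have [||u [uAde ub]] := @homogeneity _ _ _ _ hM (A `|` range (tcat d e)) _ b b1 sAde.
- exact: (small_type_countType hM).
- move=> S dS /(realized_iff DU bD dS); apply: b1D.
  apply: def_over_sub dS => z [Az|[x _ <-]]; first by left.
  by right; exists (0, x) => //; rewrite /= g0.
have uA : aut_over A u by apply: aut_over_sub uAde => z; left.
have ud x : u (d x) = d x by apply: uAde.2; right; exists (inl x).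
have uee x : u (e x) = e x by apply: uAde.2; right; exists (inr x).
have ub' : u \o b = b1 by apply/funext.
pose c1 := u c.
have uR y : u \o tcat y (tcat d (singleton c)) = tcat (u \o y) (tcat d (singleton c1)).
  by apply/funext => -[z|[z|[]]] //=; rewrite ud.
have u0 : aut_over set0 u by apply: aut_over_sub uA.
have R1 : R (tcat b1 (tcat d (singleton c1))).
  by rewrite -ub' -uR (aut_def _ u0 dR).
have Rf1 : forks_set A (fun y => R (tcat y (tcat d (singleton c1)))).
  by apply: (forks_set_aut uA _ Rf) => y; rewrite -uR (aut_def _ u0 dR).
have phi1 : sat (tcat (tcat b1 (singleton c1)) (ge 0)) phi.
  move: phib; rewrite -(sat_aut _ _ uA.1).
  have -> // : u \o tcat (tcat b (singleton c)) e = tcat (tcat b1 (singleton c1)) (ge 0).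
  by apply/funext => -[[z|z]|z] //=; rewrite /ge ?g0 //= uee.
(* infinitely many solutions along the sequence could be moved to all of it *)
have [N NP] : exists N, forall i, N <= i -> ~ sat (tcat (tcat b1 (singleton c1)) (ge i)) phi.
  apply: contrapT => /forallNP H.
  have [N|t [tm tP]] := @increasing_subsequence (fun i => sat (tcat (tcat b1 (singleton c1)) (ge i)) phi).
    have /existsNP [i /not_implyP [Ni /contrapT hi]] := H N.
    by exists i.
  have [v vA ve] := gI t id tm (fun i j ij => ij).
  apply: ginc; exists (v \o tcat b1 (singleton c1)) => i.
  have := tP i; rewrite -(sat_aut _ _ vA.1).
  have -> // : v \o tcat (tcat b1 (singleton c1)) (ge (t i)) =
      tcat (v \o tcat b1 (singleton c1)) (ge i).
  by apply/funext => -[z|z] //=; rewrite /ge /= ve.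
(* thinned out, the sequence keeps its first term and only this one satisfies
   [phi] together with [b1] and [c1] *)
pose r k := if k is k'.+1 then N + k else 0.
have rm : {homo r : i j / i < j} by move=> [|i] [|j] //=; lia.
have hI : aut_indiscernible A (g \o r) := aut_indiscernible_comp rm gI.
pose h := g \o r.
pose he i := h i \o inr.
pose hd i := h i \o inl.
have h0d : hd 0 = d by apply/funext => x; rewrite /hd /h /= g0.
have phih i : 0 < i -> ~ sat (tcat (tcat b1 (singleton c1)) (he i)) phi.
  by case: i => // i _; apply: NP; rewrite leq_addr.
pose B := A `|` range (fun p : nat * (X + 'I_n) => h p.1 p.2).
have b1h S : def_over B S -> D S -> S b1.
  move=> dS; apply: b1D; apply: def_over_sub dS => z [Az|[[i x] _ <-]]; first by left.
  by right; exists (r i, x).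
(* every [D]-generic [beta] with the sequence from [i] on is a conjugate over [A] of
   [b1] with the whole sequence *)
have move_to (beta : 'I_m -> M) i : (forall S, def_over B S -> D S -> S beta) ->
    exists gamma, [/\ R (tcat beta (tcat (hd i) (singleton gamma))),
      forks_set A (fun y => R (tcat y (tcat (hd i) (singleton gamma)))),
      sat (tcat (tcat beta (singleton gamma)) (he i)) phi &
      forall k, i < k -> ~ sat (tcat (tcat beta (singleton gamma)) (he k)) phi].
  move=> betaD.
  have [||v [vA ve]] := @homogeneity _ _ _ _ hM A _
     (tcat b1 (fun p : nat * (X + 'I_n) => h p.1 p.2))
     (tcat beta (fun p : nat * (X + 'I_n) => h (i + p.1) p.2)) sA.
  - exact: (small_type_countType hM).
  - move=> S dS S1.
    have dS' j : def_over B (fun y => S (tcat y (fun p : nat * (X + 'I_n) => h (j + p.1) p.2))).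
      apply: (def_over_subst (F := fun y => tcat y (fun p : nat * (X + 'I_n) => h (j + p.1) p.2))) dS.
        by move=> z; left.
      move=> [z|p]; first by left; exists z.
      by right; exists (h (j + p.1) p.2); split=> //; right; exists (j + p.1, p.2).
    apply: (betaD _ (dS' i)); apply: (ultrafilter_shift hM sA MT hnip i DU Da hI dS).
    by apply/(realized_iff DU b1h (dS' 0)).
  have v0 : aut_over set0 v by apply: aut_over_sub vA.
  have vh j x : v (h j x) = h (i + j) x by exact: (ve (inr (j, x))).
  have vb : v \o b1 = beta by apply/funext => z; exact: (ve (inl z)).
  have vR y : v \o tcat y (tcat d (singleton c1)) = tcat (v \o y) (tcat (hd i) (singleton (v c1))).
    by apply/funext => -[z|[z|[]]] //=; rewrite -h0d /hd /= vh addn0.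
  have vphi q : sat (tcat (tcat beta (singleton (v c1))) (he (i + q))) phi <->
      sat (tcat (tcat b1 (singleton c1)) (he q)) phi.
    rewrite -(sat_aut (tcat (tcat b1 (singleton c1)) (he q)) _ vA.1).
    have -> // : v \o tcat (tcat b1 (singleton c1)) (he q) =
       tcat (tcat beta (singleton (v c1))) (he (i + q)).
    by apply/funext => -[[z|z]|z] //=; rewrite -?vb // /he /= vh.
  exists (v c1); split.
  - by rewrite -vb -vR (aut_def _ v0 dR).
  - by apply: (forks_set_aut vA _ Rf1) => y; rewrite -vR (aut_def _ v0 dR).
  - by have := vphi 0; rewrite addn0 => ->.
  - move=> q iq; have -> : q = i + (q - i) by lia.
    by rewrite vphi; apply: phih; lia.
have /choice [C CP] : forall p : ('I_m -> M) * nat, exists gamma,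
    (forall S, def_over B S -> D S -> S p.1) ->
    [/\ R (tcat p.1 (tcat (hd p.2) (singleton gamma))),
      forks_set A (fun y => R (tcat y (tcat (hd p.2) (singleton gamma)))),
      sat (tcat (tcat p.1 (singleton gamma)) (he p.2)) phi &
      forall k, p.2 < k -> ~ sat (tcat (tcat p.1 (singleton gamma)) (he k)) phi].
  move=> [beta i] /=; have [H|H] := pselect (forall S, def_over B S -> D S -> S beta).
    by have [gamma ?] := move_to beta i H; exists gamma.
  by exists c => /H.
(* each [bb l] is also generic over the elements [C (bb j, i)] with [j < l] *)
have [bb bbP] := build_realizations hM (fun beta i => C (beta, i)) (ultra_proper (UltraFilter := DU)) (sAg h).
have bbD j S : def_over B S -> D S -> S (bb j).
  by move=> dS; apply: bbP; apply: def_over_sub dS => z; left.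
pose cc i j := C (bb j, i).
have CC i j := CP (bb j, i) (bbD j).
have [thR thRP] := dR.
have no0 (Z : Type) (z : {z : M | set0 z}) : Z by case: z.
pose ren1 (z : ('I_m + (X + unit)) + {z : M | set0 z}) : option ((X + 'I_n) + 'I_m) :=
  match z with
  | inl (inl y) => Some (inr y)
  | inl (inr (inl x)) => Some (inl (inl x))
  | inl (inr (inr _)) => None
  | inr z => no0 _ z end.
pose ren2 (z : ('I_m + unit) + 'I_n) : option ((X + 'I_n) + 'I_m) :=
  match z with
  | inl (inl y) => Some (inr y)
  | inl (inr _) => None
  | inr x => Some (inl (inr x)) end.
pose theta := fand (frename ren1 thR) (frename ren2 phi).
have thetaE i j z : sat (oapp (tcat (h i) (bb j)) z) theta <->
    R (tcat (bb j) (tcat (hd i) (singleton z))) /\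
    sat (tcat (tcat (bb j) (singleton z)) (he i)) phi.
  rewrite sat_fand !sat_rename thRP.
  have -> : oapp (tcat (h i) (bb j)) z \o ren1 =
      tcat (tcat (bb j) (tcat (hd i) (singleton z))) (@proj1_sig M (fun z => set0 z)).
    by apply/funext => -[[y|[x|[]]]|w] //; exact: (no0 _ w).
  by have -> : oapp (tcat (h i) (bb j)) z \o ren2 = tcat (tcat (bb j) (singleton z)) (he i)
    by apply/funext => -[[y|[]]|x].
apply: (no_half_grid MT hnip (theta := theta) (g := h) (b := bb) (c := cc)).
- by move=> i j; apply/thetaE; have [? _ ? _] := CC i j.
- move=> i j l jl /thetaE [Rl _]; have [_ Rff _ _] := CC i j.
  have /(ultraNot _ DU) nD := avoids_forks_set DU Da Rff.
  apply: (bbP l _ (def_over_not _) nD) Rl.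
  apply: (def_over_subst (F := fun y => tcat y (tcat (hd i) (singleton (cc i j))))) dR => [z []|].
  move=> [y|[x|[]]]; first by left; exists y.
    right; exists (hd i x); split=> //; left; right; by exists (i, inl x).
  by right; exists (cc i j); split=> //; right; exists (j, i).
- by move=> i j k' ik /thetaE [_]; have [_ _ _] := CC i j; apply.
Qed.

End Core.

Section BSTriviality.
Variables (K : Type) (L : language) (T : theory L) (M : structure L).
Hypotheses (hM : monster K T M) (hnip : monadically_NIP T).
Variable A : set M.
Hypothesis sA : small_set K A.

(** The parameters different from [c] lie in [B]. They are indexed by a finite type
    that may be empty, as [B] may be. *)
Lemma split_parameters (m : nat) (B : set M) (c : M) (S : set ('I_m -> M)) :
  def_over (B `|` [set c]) S -> exists (X : finType) (d : X -> M)
    (R : set ('I_m + (X + unit) -> M)), [/\ def_over set0 R, forall x, B (d x) &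
    forall y, S y <-> R (tcat y (tcat d (singleton c)))].
Proof.
move=> dS; have [[k theta w] [wB wS]] := def_over_pformula dS.
pose X : finType := {i : 'I_k | `[< B (w i) >]}.
pose ren (z : 'I_m + 'I_k) : 'I_m + (X + unit) := match z with
  | inl y => inl y
  | inr i => inr (if insub i is Some u then inl u else inr tt) end.
exists X, (fun u => w (val u)), (fun z => sat (z \o ren) theta); split.
- by apply: (def_overI (phi := frename (fun z => inl (ren z)) theta)
    (v := fun v : void => match v with end)) => [[]|z]; rewrite sat_rename.
- by move=> u; apply/asboolP; exact: valP u.
- move=> y; rewrite -wS /psat /=.
  have -> // : tcat y (tcat (fun u : X => w (val u)) (singleton c)) \o ren = tcat y w.
  apply/funext => -[z|i] //=; case: insubP => [u _ <- //|nB] /=.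
  by case: (wB i) => //= h; case/asboolP: nB.
Qed.

(** [b1] is generic also over the parameters of the dividing formulas [psi i]. As
    [(b1, u c)] has the type of [(b, c)] over [B], it satisfies one of them, whose
    parameters are among those over which [b1] is generic. *)
Lemma BS_triviality_finite (m : nat) (b : 'I_m -> M) (c : M) (B : set M) :
  small_set K B -> A `<=` B -> ~ forks A (tp b B) ->
  forks A (tp (tcat b (singleton c)) B) -> forks A (tp b (B `|` [set c])) -> False.
Proof.
move=> sB AB nf [phi phiP [k [psi [psiD psiP]]]] f2.
have [D [DU Db Da]] := not_forks_ultrafilter nf.
have sBc : small_set K (B `|` [set c]).
  apply: (small_set_setU hM) => //.
  apply: (small_set_sub (B' := range (fun _ : unit => c))) => [m' ->|]; first by exists tt.
  by apply: small_set_range; exact: (small_type_countType hM).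
have [S2 [dS2 S2b S2f]] := forks_formula hM sBc f2.
have [X [d [R [dR dB SR]]]] := split_parameters dS2.
pose e (z : {i : 'I_k & 'I_(plen (psi i))}) := ppar (psi (tag z)) (tagged z).
have sBe : small_set K (B `|` range e) by exact: (small_set_count hM).
have [b1 b1D] := realize hM (F := D) _ sBe.
have [||u [uB ub]] := @homogeneity _ _ _ _ hM B _ b b1 sB.
- exact: (small_type_countType hM).
- move=> S dS Sb; apply: b1D; last exact: Db.
  by apply: def_over_sub dS => z; left.
have uA := aut_over_sub AB uB.
have [i psii] : exists i, psat (tcat b1 (singleton (u c))) (psi i).
  apply/psiP/phiP/realizes_tp.
  have -> : tcat b1 (singleton (u c)) = u \o tcat b (singleton c).
    by apply/funext => -[z|[]] //=; rewrite ub.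
  exact: aut_same_type uB.
have u0 : aut_over set0 u by apply: aut_over_sub uB.
have uR y : u \o tcat y (tcat d (singleton c)) = tcat (u \o y) (tcat d (singleton (u c))).
  by apply/funext => -[z|[z|[]]] //=; apply: uB.2.
have ub' : u \o b = b1 by apply/funext.
apply: (no_two_sided_forking hM hnip sA DU Da dR (phi := pform (psi i)) (d := d) (e := ppar (psi i))
  (b := b1) (c := u c)).
- by case: (psi i) (psiD i).
- move=> S dS; apply: b1D; apply: def_over_sub dS => z [Az|[[x|j] _ <-]].
  + by left; exact: AB.
  + by left; exact: dB.
  + by right; exists (Tagged (fun i => 'I_(plen (psi i))) j).
- by rewrite -ub' -uR (aut_def _ u0 dR) -SR.
- apply: (forks_set_aut uA _ S2f) => y.
  by rewrite -uR (aut_def _ u0 dR) -SR.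
- exact: psii.
Qed.

End BSTriviality.

Theorem theorem3p6 (L : language) (T : theory L) (K : Type) (M : structure L)
    (hT : complete_theory T) (hM : monster K T M) (hnip : monadically_NIP T)
    (A : set M) (hA : small K A) :
  BS_trivial_over K A (@fork_indep L M).
Proof.
move=> I J a b c /small_typeE sI /small_typeE sJ nf.
have sA : small_set K A by apply/small_setE.
pose B := A `|` range a.
have sB : small_set K B by apply: (small_set_setU hM) => //; exact: small_set_range.
apply: contrapT => /not_orP [/contrapT H1 /contrapT H2].
have Bc : A `|` range (tcat a (singleton c)) = B `|` [set c].
  apply/seteqP; split=> z.
    by move=> [Az|[[i|[]] _ <-]]; [left; left|left; right; exists i|right].
  move=> [[Az|[i _ <-]]|->]; [by left|by right; exists (inl i)|by right; exists (inr tt)].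
rewrite Bc in H2.
have sBc : small_set K (B `|` [set c]).
  rewrite -Bc; apply: (small_set_setU hM) => //; apply: small_set_range.
  apply: (small_type_plus hM) => //; exact: (small_type_countType hM).
have [s1 [s1f s1P]] := forks_finite hM sB H1.
have [s2 [s2f s2P]] := forks_finite hM sBc H2.
have [|m [f [r fr]]] := @finite_retract J ((inl @^-1` s1) `|` s2).
  by rewrite finite_setU; split=> //; apply: finite_preimage => // x y _ _ [].
apply: (BS_triviality_finite hM hnip sA (b := b \o f) (c := c) sB).
- by move=> z; left.
- by move=> /forks_reindex.
- pose ff (z : 'I_m + unit) : J + unit := match z with inl i => inl (f i) | inr t => inr t end.
  pose rr (z : J + unit) : 'I_m + unit := match z with inl i => inl (r i) | inr t => inr t end.
  have -> : tcat (b \o f) (singleton c) = tcat b (singleton c) \o ff by apply/funext => -[].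
  apply: (s1P _ ff rr) => [|[j sj|[]] //=]; first exact: (small_type_countType hM).
  by rewrite fr //; left.
- apply: (s2P _ f r) => [|j sj]; first exact: (small_type_countType hM).
  by rewrite fr //; right.
Qed.
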